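(* Let $Z$ be a Banach space. The following assertions are equivalent: (a) $Z$ is finite-dimensional. (b) $\mathrm{QNA}(Z,Y)=\mathcal{L}(Z,Y)$ for every Banach space $Y$. (c) $\mathrm{QNA}(Z,c_0)=\mathcal{L}(Z,c_0)$. (d) $\mathrm{QNA}(X,Z)=\mathcal{L}(X,Z)$ for every Banach space $X$. (e) $\mathrm{QNA}(\ell_1,Z)=\mathcal{L}(\ell_1,Z)$.
   Context: Banach spaces are over $\mathbb{K}=\mathbb{R}$ or $\mathbb{C}$ (and $c_0$, $\ell_1$ are the usual sequence spaces over $\mathbb{K}$ with their usual norms); $B_X$ is the closed unit ball of $X$; $\mathcal{L}(X,Y)$ is the space of bounded linear operators with the operator norm. $T\in\mathcal{L}(X,Y)$ is quasi norm attaining, $T\in\mathrm{QNA}(X,Y)$, if there is $u\in\overline{T(B_X)}$ (norm closure) with $\|u\|=\|T\|$. *)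

(* Defs.v *)
From HB Require Import structures.
From mathcomp Require Import all_boot all_order all_algebra.
From mathcomp Require Import complex.
From mathcomp Require Import all_classical all_reals all_analysis.

Set Implicit Arguments.
Unset Strict Implicit.
Unset Printing Implicit Defensive.

Import Order.TTheory GRing.Theory Num.Theory.
Import numFieldNormedType.Exports.

Local Open Scope classical_set_scope.
Local Open Scope ring_scope.

Section Operators.
Context {K : numFieldType}.

Definition finite_dimensional (V : lmodType K) : Prop :=
  exists (n : nat) (e : 'I_n -> V),
    forall x : V, exists c : 'I_n -> K, x = \sum_(i < n) c i *: e i.

Definition unit_ball (X : normedModType K) : set X := [set x | `|x| <= 1].

Arguments unit_ball : clear implicits.

Context {X Y : normedModType K}.

Definition bounded_operators : set {linear X -> Y} :=
  [set T | exists M : K, forall x : X, `|T x| <= M * `|x|].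

(* Norms take their values in K; in the complex case K carries the order
   for which z <= w means that w - z is a nonnegative real, so the least upper
   bound below is the usual supremum of a set of nonnegative reals. *)
Definition opnorm (T : {linear X -> Y}) : K :=
  supremum 0 [set `|T x| | x in unit_ball X].

Definition QNA : set {linear X -> Y} :=
  [set T | bounded_operators T /\
     exists2 u : Y, closure (T @` unit_ball X) u & `|u| = opnorm T].

End Operators.
Arguments unit_ball {K} X.
Arguments bounded_operators {K} X Y.
Arguments QNA {K} X Y.

(* R is the field of real numbers (the complete Archimedean ordered field) and
   R[i] = R + iR; scalars R k ranges over exactly these two fields. *)
Variant scalar_kind := real_scalars | complex_scalars.

Definition scalars (R : realType) (k : scalar_kind) : numFieldType :=
  match k with real_scalars => R | complex_scalars => R[i] end.

Lemma complex_complete (R : realType) (F : set_system R[i]^o) :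
  ProperFilter F -> cauchy F -> cvg F.
Proof.
move=> PF /cauchyP Fc.
have normE (z : R[i]) : `|z| = (complex.Re `|z|)%:C%C by rewrite normc_def.
have sqD (u v : R) : Num.sqrt (u ^+ 2 + v ^+ 2) <= `|u| + `|v|.
  rewrite -[leRHS]ger0_norm ?addr_ge0// -sqrtr_sqr ler_sqrt ?sqr_ge0//.
  by rewrite sqrrD !real_normK ?num_real// addrAC lerDl mulrn_wge0// mulr_ge0.
have nRe (z : R[i]) : `|complex.Re z| <= complex.Re `|z|.
  by rewrite normc_def /= -sqrtr_sqr ler_sqrt ?addr_ge0 ?sqr_ge0// lerDl sqr_ge0.
have nIm (z : R[i]) : `|complex.Im z| <= complex.Re `|z|.
  by rewrite normc_def /= -sqrtr_sqr ler_sqrt ?addr_ge0 ?sqr_ge0// lerDr sqr_ge0.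
have cauchyp (p : R[i] -> R) : {morph p : x y / x - y} ->
    (forall z, `|p z| <= complex.Re `|z|) -> cvg (p @ F).
  move=> pB np; apply: R_complete; apply/cauchyP => e e0.
  have e0' : 0 < e%:C%C by rewrite ltcR.
  have [z Fz] := Fc _ e0'.
  exists (p z); change (F (p @^-1` ball (p z) e)).
  apply: filterS Fz => y; rewrite /preimage -!ball_normE /= => zy.
  rewrite -pB; apply: le_lt_trans (np _) _.
  by rewrite normE ltcR in zy.
have /cvg_ex[a Fa] : cvg (@complex.Re R @ F) by apply: cauchyp nRe => -[? ?] [].
have /cvg_ex[b Fb] : cvg (@complex.Im R @ F) by apply: cauchyp nIm => -[? ?] [].
apply/cvg_ex; exists (a +i* b)%C.
apply/cvgrPdist_lt => e e0.
have eE : e = (complex.Re e)%:C%C by rewrite RRe_real// ger0_real// ltW.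
have e20 : 0 < complex.Re e / 2 by rewrite divr_gt0//; rewrite eE ltcR in e0.
move/cvgrPdist_lt : Fa => /(_ _ e20) Fa; move/cvgrPdist_lt : Fb => /(_ _ e20) Fb.
apply: filterS2 Fa Fb => -[c d] /= ac bd.
rewrite eE normE ltcR normc_def /=.
apply: (@le_lt_trans _ _ (`|a - c| + `|b - d|)); last by rewrite [ltRHS]splitr ltrD.
exact: sqD.
Qed.

Section Limits.
Context {K : numFieldType} {T : Type} {F : set_system T} {FF : ProperFilter F}.

Lemma cvg_norm_le (V : normedModType K) (f : T -> V) (l : V) (e : K) :
  f @ F --> l -> (\forall x \near F, `|f x| <= e) -> `|l| <= e.
Proof.
move=> fl fe; have [x xe] := filter_ex fe.
have e0 : 0 <= e by apply: le_trans xe.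
rewrite real_leNgt ?ger0_real//; apply/negP => el.
have d0 : 0 < `|l| - e by rewrite subr_gt0.
move/cvgrPdist_lt : fl => /(_ _ d0) fl.
have [y [ye]] := filter_ex (filterI fe fl).
rewrite ltrBrDr => /(le_lt_trans _) ly.
suff : `|l| < `|l| by rewrite ltxx.
apply: ly; rewrite -[in leLHS](subrK (f y) l); apply: le_trans (ler_normD _ _) _.
by rewrite lerD2l.
Qed.

Lemma cvg_ge0 (f : T -> K) (l : K) :
  f @ F --> l -> (\forall x \near F, 0 <= f x) -> 0 <= l.
Proof.
move=> fl f0; suff -> : l = `|l| by [].
apply: (@norm_cvg_unique K K^o (f @ F)) => //.
apply: cvg_trans (cvg_norm fl); apply: near_eq_cvg.
by apply: filterS f0 => x; move/ger0_norm.
Qed.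

Lemma cvg_le (f g : T -> K) (l m : K) : f @ F --> l -> g @ F --> m ->
  (\forall x \near F, f x <= g x) -> l <= m.
Proof.
move=> fl gm fg; rewrite -subr_ge0; apply: (cvg_ge0 (cvgB gm fl)).
by apply: filterS fg => x; rewrite subr_ge0.
Qed.

Lemma cvg_normed_series (u : nat -> T -> K) (l : nat -> K) (n : nat) :
  (forall i, u i @ F --> l i) ->
  (fun t => [normed series (u ^~ t)] n) @ F --> [normed series l] n.
Proof.
move=> ul; elim: n => [|n IH]; rewrite /normed_series_of /series /=.
  rewrite big_geq//; under eq_fun do rewrite big_geq//; exact: cvg_cst.
rewrite big_nat_recr//=; under eq_fun do rewrite big_nat_recr//=.
by apply: cvgD; [exact: IH|exact: cvg_norm].
Qed.

End Limits.

Section ScalarsTheory.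
Context {R : realType} {k : scalar_kind}.
Local Notation K := (scalars R k).

Lemma scalars_supremums (A : set K) : A !=set0 -> A `<=` [set x | 0 <= x] ->
  ubound A !=set0 -> supremums A !=set0.
Proof.
case: k A => /= A A0 Age0 [M AM].
  have hA : has_sup A by split=> //; exists M.
  exists (sup A); split; first exact: sup_upper_bound.
  by move=> y Ay; apply: ge_sup.
have ReA x : A x -> x = (complex.Re x)%:C%C.
  by move=> /Age0 x0; rewrite RRe_real// ger0_real.
have hA : has_sup (@complex.Re R @` A).
  split; first by case: A0 => x Ax; exists (complex.Re x), x.
  exists (complex.Re M) => _ [x Ax <-].
  by have := AM _ Ax; rewrite lecE => /andP[].
exists (sup (@complex.Re R @` A))%:C%C; split.
  by move=> x Ax; rewrite (ReA x Ax) lecR; apply: sup_upper_bound => //; exists x.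
move=> y Ay; have [x0 Ax0] := A0; rewrite lecE /=.
have := Ay _ Ax0; rewrite (ReA _ Ax0) lecE /= => /andP[/eqP -> _]; rewrite eqxx /=.
apply: ge_sup; first by case: hA.
by move=> _ [x Ax <-]; have := Ay _ Ax; rewrite lecE => /andP[].
Qed.

Lemma scalars_complete (F : set_system K) : ProperFilter F -> cauchy F -> cvg F.
Proof. by case: k F => /= F; [exact: R_complete|exact: complex_complete]. Qed.

Lemma scalars_nondecreasing_cvg (u : nat -> K) (M : K) : (forall n, 0 <= u n) ->
  {homo u : m n / (m <= n)%N >-> m <= n} -> (forall n, u n <= M) -> cvgn u.
Proof.
move=> u0 und uM.
have [s [us sle]] : supremums (range u) !=set0.
  apply: scalars_supremums; first by exists (u 0%N), 0%N.
    by move=> _ [n _ <-]; apply: u0.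
  by exists M => _ [n _ <-].
have {}us n : u n <= s by apply: us; exists n.
apply/cvg_ex; exists s; apply/cvgrPdist_lt => e e0.
have [N uN] : exists N, s - e < u N.
  apply: contrapT => /forallNP nu.
  suff : s <= s - e by rewrite lerDl oppr_ge0 => /(lt_le_trans e0); rewrite ltxx.
  apply: sle => _ [n _ <-].
  have ser : s - e \is Num.real.
    by apply: realB; apply: ger0_real; [exact: le_trans (u0 0%N) (us 0%N)|exact: ltW].
  by rewrite (real_leNgt (ger0_real (u0 n)) ser); apply/negP/nu.
exists N => // n /= Nn; rewrite ger0_norm ?subr_ge0//.
by rewrite ltrBlDr -ltrBlDl (lt_le_trans uN)// und.
Qed.

Lemma opnorm_supremums (X Y : normedModType K) (T : {linear X -> Y}) :
  bounded_operators X Y T -> supremums [set `|T x| | x in unit_ball X] (opnorm T).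
Proof.
move=> [M TM].
have A0 : [set `|T x| | x in unit_ball X] !=set0.
  by exists `|T 0|, 0 => //; rewrite /unit_ball /= normr0.
have [s sT] : supremums [set `|T x| | x in unit_ball X] !=set0.
  apply: scalars_supremums => //; first by move=> _ [x _ <-]; exact: normr_ge0.
  exists `|M| => _ [x x1 <-]; have := TM x.
  have {}x1 : `|x| <= 1 by [].
  rewrite -[leLHS]normr_id => TMx; apply: le_trans (_ : `|M| * `|x| <= _); last first.
    by rewrite ler_piMr.
  have Mx : 0 <= M * `|x| by apply: le_trans TMx.
  by rewrite -[`|x|]normr_id -normrM (ger0_norm Mx) -[leLHS]normr_id.
rewrite /opnorm /supremum ifF; last exact/negbTE/set0P.
by case: xgetP => [y _ //|/(_ s)].
Qed.

Lemma coordinate_cvg (V : normedModType K) (p : V -> K) (F : set_system V) :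
  ProperFilter F -> cauchy F -> (forall y z, `|p y - p z| <= `|y - z|) ->
  cvg (p @ F).
Proof.
move=> PF /cauchyP Fc pl; apply: scalars_complete; apply/cauchyP => e e0.
have [z Fz] := Fc _ e0.
exists (p z); change (F (p @^-1` ball (p z) e)).
apply: filterS Fz => y; rewrite /preimage -!ball_normE /=.
exact: le_lt_trans.
Qed.

End ScalarsTheory.

Lemma cauchy_ball_cvg (K : numFieldType) (V : normedModType K) (F : set_system V) :
  ProperFilter F -> cauchy F ->
  (exists x, forall y e, 0 < e -> F (ball y e) -> `|x - y| <= e) -> cvg F.
Proof.
move=> PF /cauchyP Fc [x xF]; apply/cvg_ex; exists x; apply/cvgrPdist_lt => e e0.
have e20 : 0 < e / 2 by rewrite divr_gt0.
have [y Fy] := Fc _ e20; apply: filterS (Fy) => z; rewrite -ball_normE /= => yz.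
rewrite [ltRHS]splitr -[x](subrK y) -addrA (le_lt_trans (ler_normD _ _))//.
by rewrite ler_ltD// xF.
Qed.


Section SequenceSpaces.
Context (R : realType) (k : scalar_kind).
Local Notation K := (scalars R k).

(* The norms of c0 and l1 are c0_norm and l1_norm below. *)
Definition is_c0 : {pred nat -> K} := fun x => `[< x @ \oo --> (0 : K) >].

Record c0 := C0 { c0_seq :> nat -> K ; c0_seqP : c0_seq \in is_c0 }.

Definition is_l1 : {pred nat -> K} := fun x => `[< cvgn [normed series x] >].

Record l1 := L1 { l1_seq :> nat -> K ; l1_seqP : l1_seq \in is_l1 }.

End SequenceSpaces.

Section C0Theory.
Context {R : realType} {k : scalar_kind}.
Local Notation K := (scalars R k).

HB.instance Definition _ := [isSub of c0 R k for @c0_seq R k].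
HB.instance Definition _ := [Choice of c0 R k by <:].

Lemma is_c0_submod_closed : submod_closed (is_c0 (R:=R) (k:=k)).
Proof.
split; first by apply/asboolP; exact: cvg_cst.
move=> a x y /asboolP x0 /asboolP y0; apply/asboolP.
have : (fun n => a * x n + y n) @ \oo --> a * 0 + 0.
  by apply: cvgD => //; apply: cvgM => //; exact: cvg_cst.
by rewrite mulr0 addr0.
Qed.

HB.instance Definition _ :=
  GRing.isSubmodClosed.Build K (nat -> K) (is_c0 (R:=R) (k:=k)) is_c0_submod_closed.
HB.instance Definition _ := [SubChoice_isSubLmodule of c0 R k by <:].

Definition c0_norm (x : c0 R k) : K := supremum 0 (range (fun n => `|x n|)).

Lemma c0_normP (x : c0 R k) :
  (forall n, `|x n| <= c0_norm x) /\
  (forall M, (forall n, `|x n| <= M) -> c0_norm x <= M).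
Proof.
have [s sx] : supremums (range (fun n => `|x n|)) !=set0.
  apply: scalars_supremums; first by exists `|x 0%N|, 0%N.
    by move=> _ [n _ <-] /=.
  have /asboolP/cvgrPdist_lt/(_ _ ltr01)[N _ xN] := c0_seqP x.
  exists (1 + \sum_(i < N) `|x i|) => _ [n _ <-].
  have [Nn|nN] := leqP N n.
    apply: (@le_trans _ _ 1); last by rewrite lerDl sumr_ge0.
    by have := xN _ Nn; rewrite sub0r normrN => /ltW.
  rewrite (bigD1 (Ordinal nN))//= addrCA lerDl addr_ge0// sumr_ge0//.
have -> : c0_norm x = s.
  rewrite /c0_norm /supremum ifF; last first.
    by apply/negbTE/set0P; exists `|x 0%N|, 0%N.
  by case: xgetP => [y _ ys|/(_ s)//]; apply: is_subset1_supremums ys sx.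
split=> [n|M xM]; first by apply: sx.1; exists n.
by apply: sx.2 => _ [n _ <-].
Qed.

Lemma c0_normD (x y : c0 R k) : c0_norm (x + y) <= c0_norm x + c0_norm y.
Proof.
apply: (c0_normP (x + y)).2 => n /=; apply: le_trans (ler_normD _ _) _.
by apply: lerD; [exact: (c0_normP x).1|exact: (c0_normP y).1].
Qed.

Lemma c0_norm_eq0 (x : c0 R k) : c0_norm x = 0 -> x = 0.
Proof.
move=> x0; apply/val_inj/funext => n /=; apply/eqP.
by rewrite -normr_le0 -x0; exact: (c0_normP x).1.
Qed.

Lemma c0_normZ (a : K) (x : c0 R k) : c0_norm (a *: x) = `|a| * c0_norm x.
Proof.
have le b y : c0_norm (b *: y) <= `|b| * c0_norm y.
  apply: (c0_normP (b *: y)).2 => n.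
  by rewrite [leLHS]normrM ler_wpM2l//; exact: (c0_normP y).1.
apply/eqP; rewrite eq_le le /=.
have [->|a0] := eqVneq a 0.
  rewrite normr0 mul0r; exact: le_trans (normr_ge0 _) ((c0_normP _).1 0%N).
rewrite mulrC -ler_pdivlMr ?normr_gt0// mulrC -normfV.
by apply: le_trans (le _ _); rewrite scalerA mulVf// scale1r.
Qed.

HB.instance Definition _ := Lmodule_isNormed.Build K (c0 R k)
  c0_normD c0_normZ c0_norm_eq0.

Lemma c0_complete (F : set_system (c0 R k)) : ProperFilter F -> cauchy F -> cvg F.
Proof.
move=> PF Fc; apply: cauchy_ball_cvg => //.
have /choice[x Fx] n : exists l : K, (fun z : c0 R k => z n) @ F --> l.
  apply/cvg_ex; apply: coordinate_cvg => // y z.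
  exact: (c0_normP (y - z)).1.
have xy y e : F (ball y e) -> forall n, `|x n - y n| <= e.
  move=> Fy n; apply: (cvg_norm_le (F := F) (f := fun z : c0 R k => z n - y n)).
    by apply: cvgB; [exact: (Fx n)|exact: cvg_cst].
  apply: filterS Fy => z; rewrite -ball_normE /= distrC => /ltW; apply: le_trans.
  exact: (c0_normP (z - y)).1.
have x0 : x \in is_c0 (R:=R) (k:=k).
  apply/asboolP/cvgrPdist_le => e e0.
  have e20 : 0 < e / 2 by rewrite divr_gt0.
  have /cauchyP/(_ _ e20)[y /xy xye] := Fc.
  have /asboolP/cvgrPdist_le/(_ _ e20) := c0_seqP y.
  apply: filterS => n yn; rewrite [leRHS]splitr -[0 - _](subrK (0 - y n)).
  apply: le_trans (ler_normD _ _) _; rewrite lerD//.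
  by rewrite !sub0r opprK addrC distrC.
exists (C0 x0) => y e e0 /xy xye; exact: (c0_normP (C0 x0 - y)).2.
Qed.

HB.instance Definition _ := Uniform_isComplete.Build (c0 R k) c0_complete.

End C0Theory.

Section L1Theory.
Context {R : realType} {k : scalar_kind}.
Local Notation K := (scalars R k).

HB.instance Definition _ := [isSub of l1 R k for @l1_seq R k].
HB.instance Definition _ := [Choice of l1 R k by <:].

Lemma normed_series_nondecreasing (x : nat -> K) :
  {homo [normed series x] : m n / (m <= n)%N >-> m <= n}.
Proof.
move=> m n mn; rewrite -subr_ge0 sub_series_geq//.
by apply: sumr_ge0 => i _; exact: normr_ge0.
Qed.

Lemma is_l1_bounded (x : nat -> K) (M : K) :
  (forall n, [normed series x] n <= M) -> x \in is_l1 (R:=R) (k:=k).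
Proof.
move=> xM; apply/asboolP; apply: scalars_nondecreasing_cvg xM.
  by move=> n; apply: sumr_ge0 => i _; exact: normr_ge0.
exact: normed_series_nondecreasing.
Qed.

Lemma normed_series_le_lim (x : nat -> K) : x \in is_l1 (R:=R) (k:=k) ->
  forall n, [normed series x] n <= limn [normed series x].
Proof.
move=> /asboolP cx n; apply: (cvg_le (F := \oo) (cvg_cst _) cx).
by exists n => // m /=; exact: normed_series_nondecreasing.
Qed.

Lemma normed_series_linear_le (a : K) (x y : nat -> K) :
  x \in is_l1 (R:=R) (k:=k) -> y \in is_l1 (R:=R) (k:=k) ->
  forall n, [normed series (a *: x + y)] n <=
    `|a| * limn [normed series x] + limn [normed series y].
Proof.
move=> lx ly n; apply: (@le_trans _ _
    (`|a| * [normed series x] n + [normed series y] n)); last first.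
  by apply: lerD; [apply: ler_wpM2l => //|]; exact: normed_series_le_lim.
rewrite /series /= mulr_sumr -big_split /=; apply: ler_sum => i _.
by rewrite -normrM; exact: ler_normD.
Qed.

Lemma is_l1_submod_closed : submod_closed (is_l1 (R:=R) (k:=k)).
Proof.
split; last first.
  by move=> a x y lx ly; apply: is_l1_bounded (normed_series_linear_le a lx ly).
apply: (@is_l1_bounded _ 0) => n; rewrite /normed_series_of /series /= big1// => i _.
exact: normr0.
Qed.

HB.instance Definition _ :=
  GRing.isSubmodClosed.Build K (nat -> K) (is_l1 (R:=R) (k:=k)) is_l1_submod_closed.
HB.instance Definition _ := [SubChoice_isSubLmodule of l1 R k by <:].

Definition l1_norm (x : l1 R k) : K := limn [normed series x].

Lemma l1_normP (x : l1 R k) :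
  (forall n, [normed series x] n <= l1_norm x) /\
  (forall M, (forall n, [normed series x] n <= M) -> l1_norm x <= M).
Proof.
split=> [|M xM]; first exact: normed_series_le_lim (l1_seqP x).
have /asboolP cx := l1_seqP x.
by apply: (cvg_le (F := \oo) cx (cvg_cst M)); exists 0%N => // n _; exact: xM.
Qed.

Lemma l1_norm_ge_coord (x : l1 R k) n : `|x n| <= l1_norm x.
Proof.
apply: le_trans ((l1_normP x).1 n.+1).
by rewrite /normed_series_of /series /= big_nat_recr//= lerDr sumr_ge0.
Qed.

Lemma l1_norm_eq0 (x : l1 R k) : l1_norm x = 0 -> x = 0.
Proof.
move=> x0; apply/val_inj/funext => n /=; apply/eqP.
by rewrite -normr_le0 -x0; exact: l1_norm_ge_coord.
Qed.

Lemma l1_norm_linear_le (a : K) (x y : l1 R k) :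
  l1_norm (a *: x + y) <= `|a| * l1_norm x + l1_norm y.
Proof.
apply: (l1_normP _).2; exact: normed_series_linear_le (l1_seqP x) (l1_seqP y).
Qed.

Lemma l1_normD (x y : l1 R k) : l1_norm (x + y) <= l1_norm x + l1_norm y.
Proof. by have := l1_norm_linear_le 1 x y; rewrite scale1r normr1 mul1r. Qed.

Lemma l1_normZ (a : K) (x : l1 R k) : l1_norm (a *: x) = `|a| * l1_norm x.
Proof.
have n0 : l1_norm 0 = 0.
  apply/eqP; rewrite eq_le (le_trans (normr_ge0 _) (l1_norm_ge_coord 0 0)) andbT.
  apply: (l1_normP 0).2 => n; rewrite /normed_series_of /series /= big1// => i _; exact: normr0.
have le b y : l1_norm (b *: y) <= `|b| * l1_norm y.
  by have := l1_norm_linear_le b y 0; rewrite !addr0 n0 addr0.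
apply/eqP; rewrite eq_le le /=.
have [->|a0] := eqVneq a 0; first by rewrite normr0 mul0r scale0r n0.
rewrite mulrC -ler_pdivlMr ?normr_gt0// mulrC -normfV.
by apply: le_trans (le _ _); rewrite scalerA mulVf// scale1r.
Qed.

HB.instance Definition _ := Lmodule_isNormed.Build K (l1 R k)
  l1_normD l1_normZ l1_norm_eq0.

Lemma l1_complete (F : set_system (l1 R k)) : ProperFilter F -> cauchy F -> cvg F.
Proof.
move=> PF Fc; apply: cauchy_ball_cvg => //.
have /choice[x Fx] n : exists l : K, (fun z : l1 R k => z n) @ F --> l.
  apply/cvg_ex; apply: coordinate_cvg => // y z.
  exact: l1_norm_ge_coord (y - z) n.
have xy (y : l1 R k) e : F (ball y e) -> forall n, [normed series (x - y)] n <= e.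
  move=> Fy n; apply: (cvg_le (F := F)
    (f := fun z : l1 R k => [normed series (z - y)] n) (g := fun=> e)).
  - apply: (cvg_normed_series (u := fun i (z : l1 R k) => z i - y i)) => i.
    by apply: cvgB; [exact: (Fx i)|exact: cvg_cst].
  - exact: cvg_cst.
  - apply: filterS Fy => z; rewrite -ball_normE /= distrC => /ltW; apply: le_trans.
    exact: (l1_normP (z - y)).1.
have lx : x \in is_l1 (R:=R) (k:=k).
  have /cauchyP/(_ _ ltr01)[y /xy xy1] := Fc.
  by rewrite -[x](subrK (y : nat -> K)) rpredD ?l1_seqP//; exact: is_l1_bounded xy1.
exists (L1 lx) => y e e0 /xy xye; exact: (l1_normP (L1 lx - y)).2.
Qed.

HB.instance Definition _ := Uniform_isComplete.Build (l1 R k) l1_complete.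

End L1Theory.

(* Main.v *)
Require Import Defs.
From HB Require Import structures.
From mathcomp Require Import all_boot all_order all_algebra.
From mathcomp Require Import complex ring lra zify.
From mathcomp Require Import all_classical all_reals all_analysis.

(** Operators with values in a finite-dimensional subspace attain the norm
    after passing to a limit of a maximizing sequence, which gives (b), (c), (d)
    and (e) from (a).

    (c) implies (a).  By the Josefson-Nissenzweig theorem an infinite-dimensional
    Z carries functionals f_n which tend to 0 pointwise but not in norm; then
    z |-> ((1 - 1/(n+2)) f_n(z) / ||f_n||)_n is an operator into c0 of norm 1, and
    each element of c0 whose n-th coordinate is at most 1 - 1/(n+2) has norm
    less than 1.

    Josefson-Nissenzweig.  Take a separated sequence of functionals of norm at
    most 1.  If a subsequence converges pointwise, its consecutive differences do
    the job.  Otherwise Rosenthal's argument gives a subsequence whose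
    level sets {f_n > q}, {f_n < p} are Boolean independent on the unit ball, so
    that all dyadic averages (with signs) of distinct terms have norm at least
    (q - p)/2.  Either a diagonal sequence of such averages tends to 0 pointwise,
    or there is a sequence W and theta > 0 such that no block sequence of W is
    eventually below theta at all points of the ball (Hagler-Johnson).  In the
    latter case, pairing the terms repeatedly, replacing a pair by its mean and
    recording half its difference, produces Rademacher-like functionals: by the
    parallelogram identity the squares of the recorded values sum to at most 1 at
    every point, while the n-th one stays above theta at a fixed point x_n.
    Limits along an ultrafilter give an infinite sequence with the same
    properties, hence tending to 0 pointwise.

    (e) implies (a).  As in Mazur's construction of basic sequences, choose unit
    vectors x_n and finite sets Phi_n of functionals that are 1/2-norming on
    span(x_i : i < n) and vanish at x_m for m >= n.  The operator
    a |-> sum_n (1 - 1/(n+2)) a_n x_n on l1 has norm 1.  If u is a limit of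
    images of b_j in the unit ball and a is the coordinatewise limit of the b_j,
    then all Phi_n annihilate u - T a, so that u = T a, and ||T a|| < 1. *)

Set Implicit Arguments.
Unset Strict Implicit.
Unset Printing Implicit Defensive.

Import Order.TTheory GRing.Theory Num.Theory.
Import numFieldNormedType.Exports.

Local Open Scope classical_set_scope.
Local Open Scope ring_scope.

(** * Infinite sets of indices and Boolean independence *)

(** Dependent choice in which each new term may depend on the list of all earlier ones. *)
Lemma history_choice (A : Type) (P : seq A -> A -> Prop) :
  (forall l, exists a, P l a) ->
  exists u : nat -> A, forall n, P (mkseq u n) (u n).
Proof.
move=> /choice[f Pf].
pose s := fix s n := if n is n'.+1 then rcons (s n') (f (s n')) else [::].
exists (fun n => f (s n)) => n.
suff -> : mkseq (fun n => f (s n)) n = s n by [].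
by elim: n => // n IH; rewrite mkseqS IH.
Qed.

Lemma invariant_choice (A : Type) (I : nat -> A -> Prop)
    (Q : nat -> A -> A -> Prop) (a0 : A) : I 0%N a0 ->
  (forall n a, I n a -> exists b, I n.+1 b /\ Q n a b) ->
  exists u : nat -> A, [/\ u 0%N = a0, forall n, I n (u n) &
    forall n, Q n (u n) (u n.+1)].
Proof.
move=> I0 IQ.
have /choice[f fP] (na : nat * A) : exists b,
    I na.1 na.2 -> I na.1.+1 b /\ Q na.1 na.2 b.
  have [/IQ[b bP]|nI] := pselect (I na.1 na.2); first by exists b.
  (* Where the invariant fails, [a0] serves as a default value; the sequence built below never meets
     this case. *)
  by exists a0.
pose u := fix u n := if n is n'.+1 then f (n', u n') else a0.
have Iu n : I n (u n) by elim: n => //= n /(fP (n, u n))[].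
by exists u; split=> // n; have [] := fP (n, u n) (Iu n).
Qed.

Section UnboundedSets.

(** Infinite sets of indices stand for subsequences: thinning a subsequence means passing to a
    smaller unbounded set. *)
Definition unbounded (M : set nat) := forall N, exists2 n, (N <= n)%N & M n.

Lemma sub_unbounded (M M' : set nat) : M `<=` M' -> unbounded M -> unbounded M'.
Proof. by move=> MM' uM N; have [n ? /MM'] := uM N; exists n. Qed.

Lemma unbounded_tail (M : set nat) (N : nat) :
  unbounded M -> unbounded (M `&` [set n | (N <= n)%N]).
Proof.
move=> uM n; have [m + Mm] := uM (maxn n N).
by rewrite geq_max => /andP[nm Nm]; exists m.
Qed.

Lemma unbounded_pigeonhole (I : finType) (f : nat -> I) :
  exists i, unbounded [set n | f n = i].
Proof.
apply: contrapT => /forallNP nu.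
have /choice[b bP] i : exists N, forall n, (N <= n)%N -> f n <> i.
  have /existsNP[N NP] := nu i; exists N => n Nn fn.
  by apply: NP; exists n.
by apply: (bP (f (\max_i b i)) (\max_i b i)) => //; exact: leq_bigmax.
Qed.

Lemma increasing_ge (n : nat -> nat) : (forall j, (n j < n j.+1)%N) ->
  forall j, (j <= n j)%N.
Proof. by move=> ni; elim=> // j /leq_ltn_trans; apply. Qed.

Lemma increasing_lt (n : nat -> nat) : (forall j, (n j < n j.+1)%N) ->
  forall i j, (n i < n j)%N -> (i < j)%N.
Proof.
move=> ni i j; apply: contraTT; rewrite -!leqNgt => ij.
by rewrite -(subnK ij); elim: (i - j)%N => // d /leq_trans; apply; exact: ltnW.
Qed.

(** Greedy choice. For a decreasing family [M] this yields the diagonal subsequence. *)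
Lemma unbounded_enum (M : nat -> set nat) :
  (forall j, unbounded (M j)) ->
  exists n : nat -> nat, (forall j, (n j < n j.+1)%N) /\ forall j, M j (n j).
Proof.
move=> uM; have [n0 _ Mn0] := uM 0%N 0%N.
have [|j a Mja|n [_ Mn nn]] := @invariant_choice nat M (fun _ a b => (a < b)%N) n0.
- by [].
- by have [b ab Mb] := uM j.+1 a.+1; exists b.
- by exists n.
Qed.

End UnboundedSets.

Section BooleanIndependence.
Context {X : Type} (A : bool -> nat -> set X).

Definition oscillates (M : set nat) (x : X) :=
  forall b, unbounded (M `&` [set n | A b n x]).

(** No thinning of [M] makes every point of [S] stop oscillating; the condition is inherited by
    unbounded subsets of [M]. *)
Definition fully_oscillating (M : set nat) (S : set X) :=
  forall M', unbounded M' -> M' `<=` M -> exists2 x, S x & oscillates M' x.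

(* Otherwise one diagonalizes: some pair (i, b) recurs along a set D of chosen
   indices n_j, and a point of S i oscillating along D lies in A b n_j for one
   of them, while the later indices were chosen so that no point of
   S i `&` A b n_j oscillates along them. *)
Lemma fully_oscillating_split (I : finType) (S : I -> set X) (M : set nat) :
  unbounded M -> (forall i, fully_oscillating M (S i)) ->
  exists n M', [/\ M n, unbounded M', M' `<=` M `&` [set m | (n < m)%N] &
    forall i b, fully_oscillating M' (S i `&` A b n)].
Proof.
move=> uM MS; apply: contrapT => nsplit.
pose Q (M1 M2 : set nat) := exists n i b, [/\ M1 n,
  M2 `<=` M1 `&` [set m | (n < m)%N] &
  forall x, S i x -> A b n x -> ~ oscillates M2 x].
have [|_ M1 [uM1 M1M]|Ms [Ms0 Msu MsQ]] := @invariant_choice _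
    (fun _ M1 => unbounded M1 /\ M1 `<=` M) (fun _ => Q) M.
- by split.
- have [n _ M1n] := uM1 0%N.
  set M2 := M1 `&` [set m | (n.+1 <= m)%N].
  have uM2 : unbounded M2 by exact: unbounded_tail.
  apply: contrapT => nQ; apply: nsplit; exists n, M2; split=> //.
  + exact: M1M.
  + by move=> m [/M1M].
  + move=> i b M3 uM3 M32; apply: contrapT => nosc; apply: nQ; exists M3; split.
      by split=> // m /M32[/M1M].
    exists n, i, b; split=> // x Sx Ax osc; apply: nosc; by exists x.
have [n nP] := choice MsQ; have [i iP] := choice nP; have [b bP] := choice iP.
have Mn j : Ms j (n j) by have [] := bP j.
have Mss j : Ms j.+1 `<=` Ms j by move=> m; have [_ + _] := bP j => /[apply] -[].
have Mle j k : (j <= k)%N -> Ms k `<=` Ms j.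
  move=> jk; rewrite -(subnK jk); elim: (k - j)%N => // d IH.
  by apply: subset_trans IH; exact: Mss.
have nn j : (n j < n j.+1)%N.
  by have [_ /(_ _ (Mn j.+1))[]] := bP j.
have [[i0 b0] uJ] := unbounded_pigeonhole (fun j => (i j, b j)).
pose D := [set n j | j in [set j | (i j, b j) = (i0, b0)]].
have [||x Sx Dx] := MS i0 D.
- move=> N; have [j Nj Jj] := uJ N; exists (n j); last by exists j.
  exact: leq_trans Nj (increasing_ge nn j).
- by move=> _ [j _ <-]; apply: (proj2 (Msu j)).
have [_ _ [[j [ij bj] <-] /= Ax]] := Dx b0 0%N.
have [_ _ nosc] := bP j; apply: (nosc x); [by rewrite ij|by rewrite bj|].
move=> c N; have [l lN [[k _ kl] /= Al]] := Dx c (maxn N (n j).+1).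
rewrite -{}kl in lN Al; move: lN; rewrite geq_max => /andP[Nk /(increasing_lt nn) jk].
by exists (n k) => //; split=> //; exact: Mle (Mn k).
Qed.

(** The splitting is iterated on a finite family of subsets of [B], whose index type doubles at each
    step. After [m] steps every sign pattern of length [m] has a member inside the corresponding
    intersection, and full oscillation makes that member nonempty. *)
Lemma boolean_independent_subsequence (B : set X) (M : set nat) :
  unbounded M -> fully_oscillating M B ->
  exists n : nat -> nat, forall (s : nat -> bool) m,
    exists2 x, B x & forall j, (j < m)%N -> A (s j) (n j) x.
Proof.
move=> uM MB.
pose St := ({I : finType & I -> set X} * set nat)%type.
pose Inv (_ : nat) (t : St) := unbounded t.2 /\
  forall i, fully_oscillating t.2 (projT2 t.1 i).
pose Q (_ : nat) (t t' : St) := exists n, forall i b, exists i',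
  projT2 t'.1 i' `<=` projT2 t.1 i `&` A b n.
pose t0 : St := (existT (fun I : finType => I -> set X) unit (fun=> B), M).
have [|k [[I S] M1] [/= uM1 M1S]|t [t0E It Qt]] := @invariant_choice St Inv Q t0.
- by [].
- have [n [M2 [_ uM2 _ M2S]]] := fully_oscillating_split uM1 M1S.
  exists (existT (fun I : finType => I -> set X) (I * bool)%type
    (fun ib => S ib.1 `&` A ib.2 n), M2); split.
    by split=> // -[i b]; exact: M2S.
  by exists n => i b; exists (i, b).
have [n nP] := choice Qt; exists n => s m.
have [i iP] : exists i, projT2 (t m).1 i `<=`
    B `&` [set x | forall j, (j < m)%N -> A (s j) (n j) x].
  elim: m => [|m [i iP]]; first by rewrite t0E; exists tt => x.
  have [i' i'P] := nP m i (s m); exists i' => x /i'P[/iP[Bx Ax] Amx].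
  by split=> // j; rewrite ltnS leq_eqVlt => /predU1P[->|/Ax].
have [um om] := It m.
by have [x /iP[Bx Ax] _] := om i _ um (@subset_refl _ _); exists x.
Qed.

End BooleanIndependence.

(** * Rosenthal's dichotomy: pointwise convergence or independent level sets *)

Lemma not_unbounded (M : set nat) : ~ unbounded M ->
  exists N, forall n, (N <= n)%N -> ~ M n.
Proof.
move=> /existsNP[N NP]; exists N => n Nn Mn; apply: NP; by exists n.
Qed.

(** The limit is the upper limit, the supremum of the levels exceeded infinitely often. Two
    rationals between [sup S - e] and [sup S] would be crossed infinitely often if the values kept
    falling below [sup S - e]. *)
Lemma cvg_not_oscillating (R : realType) (u : nat -> R) (M : R) :
  (forall n, `|u n| <= M) ->
  (forall p q : rat, p < q ->
    ~ (unbounded [set n | ratr q < u n] /\ unbounded [set n | u n < ratr p])) ->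
  cvgn u.
Proof.
move=> uM nosc.
pose S := [set t : R | unbounded [set n | t < u n]].
have hS : has_sup S.
  split; first (exists (- M - 1) => N; exists N => //=).
    by have := uM N; rewrite ler_norml => /andP[+ _]; apply: lt_le_trans; lra.
  exists M => t /(_ 0%N)[n _ /= /ltW tu]; apply: le_trans tu _.
  by have := uM n; rewrite ler_norml => /andP[].
apply/cvg_ex; exists (sup S); apply/cvgrPdist_le => e e0.
have [q qe] := @rat_in_itvoo R (sup S - e) (sup S) ltac:(lra).
have [p pe] := @rat_in_itvoo R (sup S - e) (ratr q) ltac:(by move: qe; rewrite in_itv => /andP[]).
move: qe pe; rewrite !in_itv /= => /andP[qe1 qe2] /andP[pe1 pe2].
have [t St qt] := sup_adherent (eps := sup S - ratr q) ltac:(lra) hS.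
have uq : unbounded [set n | ratr q < u n].
  by apply: sub_unbounded St => n /=; apply: lt_trans; move: qt; rewrite subKr.
have [N1 N1P] : exists N, forall n, (N <= n)%N -> ~ u n < ratr p.
  apply: not_unbounded => up; apply: (nosc p q); last by [].
  by rewrite -(ltr_rat R).
have [N2 N2P] : exists N, forall n, (N <= n)%N -> ~ sup S + e < u n.
  apply: not_unbounded => ue; have := sup_upper_bound hS ue; lra.
exists (maxn N1 N2) => // n; rewrite /= geq_max => /andP[/N1P n1 /N2P n2].
move/negP: n1; move/negP: n2; rewrite -!leNgt => n2 n1.
by rewrite ler_norml; apply/andP; split; lra.
Qed.

Section Rosenthal.
Context {R : realType} {X : Type} (B : set X) (y : nat -> X -> R).

Definition above_below (p q : R) (b : bool) (n : nat) : set X :=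
  if b then [set x | q < y n x] else [set x | y n x < p].

(** Without an independent sequence, any index set can be thinned until no point of [B] oscillates
    across a given pair. Stage [j] treats the rational pair coded by [j], and the diagonal sequence
    handles all pairs at once. *)
Lemma cvg_or_independent (M : R) :
  (forall n x, B x -> `|y n x| <= M) ->
  (exists n : nat -> nat, (forall k, (n k < n k.+1)%N) /\
     forall x, B x -> cvgn (fun k => y (n k) x)) \/
  (exists (p q : R) (n : nat -> nat), p < q /\ forall (s : nat -> bool) m,
    exists2 x, B x & forall j, (j < m)%N -> above_below p q (s j) (n j) x).
Proof.
move=> yM; apply: contrapT => /not_orP[ncvg nind]; apply: ncvg.
have nosc p q M0 : p < q -> unbounded M0 -> exists M1, [/\ unbounded M1, M1 `<=` M0 &
    forall x, B x -> ~ oscillates (above_below p q) M1 x].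
  move=> pq uM0; apply: contrapT => nM; apply: nind.
  have [|n nP] := @boolean_independent_subsequence _ (above_below p q) B _ uM0.
    move=> M' uM' M'M; apply: contrapT => nx; apply: nM; exists M'; split=> //.
    by move=> x Bx ox; apply: nx; exists x.
  by exists p, q, n.
pose Q (j : nat) (M0 M1 : set nat) := M1 `<=` M0 /\ forall p q : rat, p < q ->
  unpickle j = Some (p, q) ->
  forall x, B x -> ~ oscillates (above_below (ratr p) (ratr q)) M1 x.
have [|j M0 uM0|Ms [_ uMs MsQ]] :=
    @invariant_choice _ (fun _ => unbounded) Q setT.
- by move=> N; exists N.
- case uj : (unpickle j : option (rat * rat)) => [[p q]|]; last first.
    by exists M0; split=> //; split=> // p q _; rewrite uj.
  have [pq|pq] := boolP (p < q); last first.
    exists M0; split=> //; split=> // p' q' p'q'.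
    by rewrite uj => -[pE qE]; move: pq; rewrite pE qE p'q'.
  have [M1 [uM1 M10 M1P]] := @nosc (ratr p) (ratr q) M0 ltac:(by rewrite ltr_rat) uM0.
  by exists M1; split=> //; split=> // p' q' _; rewrite uj => -[<- <-].
have [n [nn Mn]] := unbounded_enum uMs.
exists n; split=> // x Bx; apply: (@cvg_not_oscillating _ _ M).
  by move=> k; exact: yM.
move=> p q pq [uq up].
have [_ /(_ p q pq (pickleK _) x Bx)] := MsQ (pickle (p, q)); apply.
have Mle j k : (j <= k)%N -> Ms k `<=` Ms j.
  move=> jk; rewrite -(subnK jk); elim: (k - j)%N => // d IH.
  by apply: subset_trans IH; exact: (MsQ _).1.
move=> b N.
(* From the index [(pickle (p, q)).+1] on, the diagonal runs inside the set obtained after the pair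
   [(p, q)] was treated. *)
have [k Nk kP] : exists2 k, (maxn N (pickle (p, q)).+1 <= k)%N &
    above_below (ratr p) (ratr q) b (n k) x.
  by case: b; [exact: uq|exact: up].
move: Nk; rewrite geq_max => /andP[Nk pk].
exists (n k); first exact: leq_trans Nk (increasing_ge nn k).
by split=> //; apply: Mle (Mn k).
Qed.

End Rosenthal.

(** * Dyadic averages with signs *)

(** Trees encode iterated means: a node is half the sum of its subtrees for the sign [false], and
    half their difference for [true]. *)
Inductive dyadic := Leaf of nat | Node of bool & dyadic & dyadic.

Fixpoint leaves (t : dyadic) : seq nat :=
  match t with Leaf n => [:: n] | Node _ t1 t2 => leaves t1 ++ leaves t2 end.

Section Dyadic.
Context {R : realType} {X : Type} (B : set X) (z : nat -> X -> R).

Fixpoint dyadic_eval (t : dyadic) (x : X) : R :=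
  match t with
  | Leaf n => z n x
  | Node b t1 t2 => (dyadic_eval t1 x + (-1) ^+ b * dyadic_eval t2 x) / 2
  end.

(** The pattern [s] asks for a value above [q] at leaves entering with a plus sign and below [p] at
    the others. Compared with the opposite pattern, each signed term gains at least [q - p], and the
    absolute weights sum to 1. *)
Lemma eval_separates (p q : R) (t : dyadic) : uniq (leaves t) ->
  exists s : nat -> bool, forall x x',
    (forall j, j \in leaves t -> above_below z p q (s j) j x) ->
    (forall j, j \in leaves t -> above_below z p q (~~ s j) j x') ->
    q - p <= dyadic_eval t x - dyadic_eval t x'.
Proof.
elim: t => [n _|b t1 IH1 t2 IH2] /=.
  exists (fun=> true) => x x' /(_ n (mem_head _ _)) /= zx /(_ n (mem_head _ _)) /= zx'.
  lra.
rewrite cat_uniq => /and3P[/IH1[s1 s1P] /hasPn t12 /IH2[s2 s2P]].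
(* Distinct leaves allow the two patterns to be glued; a minus sign at the root exchanges above and
   below on the second subtree. *)
exists (fun j => if j \in leaves t1 then s1 j else b (+) s2 j) => x x' xP x'P.
have h1 : q - p <= dyadic_eval t1 x - dyadic_eval t1 x'.
  apply: s1P => j jt.
  - by have := xP j; rewrite mem_cat jt; apply.
  - by have := x'P j; rewrite mem_cat jt; apply.
have {}xP j : j \in leaves t2 -> above_below z p q (b (+) s2 j) j x.
  by move=> jt; have := xP j; rewrite mem_cat jt (negbTE (t12 _ jt)) orbT; apply.
have {}x'P j : j \in leaves t2 -> above_below z p q (~~ (b (+) s2 j)) j x'.
  by move=> jt; have := x'P j; rewrite mem_cat jt (negbTE (t12 _ jt)) orbT; apply.
case: b xP x'P => /= xP x'P.
  have h2 : q - p <= dyadic_eval t2 x' - dyadic_eval t2 x.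
    by apply: s2P => // j /x'P; rewrite negbK.
  rewrite expr1; lra.
have h2 : q - p <= dyadic_eval t2 x - dyadic_eval t2 x' by exact: s2P.
rewrite expr0; lra.
Qed.

(** Independence realizes both the separating pattern and its opposite. The two values differ by at
    least [q - p], so one of them has absolute value at least half of that. *)
Lemma eval_lower_bound (p q : R) :
  (forall (s : nat -> bool) m,
    exists2 x, B x & forall j, (j < m)%N -> above_below z p q (s j) j x) ->
  forall t, uniq (leaves t) -> exists2 x, B x & (q - p) / 2 <= `|dyadic_eval t x|.
Proof.
move=> ind t /(eval_separates p q)[s sP].
pose m := (\max_(j <- leaves t) j).+1.
have jm j : j \in leaves t -> (j < m)%N.
  by move=> jt; rewrite ltnS; exact: leq_bigmax_seq.
have [x Bx xP] := ind s m; have [x' Bx' x'P] := ind (fun j => ~~ s j) m.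
have h := sP x x' (fun j jt => xP j (jm j jt)) (fun j jt => x'P j (jm j jt)).
have [xq|xq] := leP ((q - p) / 2) `|dyadic_eval t x|; first by exists x.
exists x' => //; have := ler_norm (dyadic_eval t x); have := ler_norm (- dyadic_eval t x').
rewrite normrN; lra.
Qed.

End Dyadic.

(** * Disjoint blocks and block sequences *)

Section Blocks.

Definition disjoint_blocks (V : nat -> dyadic) :=
  (forall k, uniq (leaves (V k))) /\
  forall k l, k <> l -> forall j, j \in leaves (V k) -> j \notin leaves (V l).

Inductive dyadic_over (W : nat -> dyadic) (N : nat) : dyadic -> Prop :=
| Over_leaf i : (N <= i)%N -> dyadic_over W N (W i)
| Over_node b t1 t2 : dyadic_over W N t1 -> dyadic_over W N t2 ->
    dyadic_over W N (Node b t1 t2).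

(** The [k]-th block uses only terms of index at least [k], so an eventual bound on [W] at a point
    is inherited by [V]. *)
Definition blocks_of (W V : nat -> dyadic) := forall k, dyadic_over W k (V k).

Lemma dyadic_over_le (W : nat -> dyadic) (m n : nat) (t : dyadic) :
  (m <= n)%N -> dyadic_over W n t -> dyadic_over W m t.
Proof.
move=> mn; elim=> [i ni|b t1 t2 _ IH1 _ IH2].
  by apply: Over_leaf; exact: leq_trans ni.
exact: Over_node.
Qed.

Lemma dyadic_over_trans (W V : nat -> dyadic) (n : nat) (t : dyadic) :
  blocks_of W V -> dyadic_over V n t -> dyadic_over W n t.
Proof.
move=> WV; elim=> [i ni|b t1 t2 _ IH1 _ IH2]; last exact: Over_node.
exact: dyadic_over_le (WV i).
Qed.

Lemma blocks_of_refl (W : nat -> dyadic) : blocks_of W W.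
Proof. by move=> k; exact: Over_leaf. Qed.

Lemma blocks_of_trans (W V U : nat -> dyadic) :
  blocks_of W V -> blocks_of V U -> blocks_of W U.
Proof. by move=> WV VU k; exact: dyadic_over_trans (VU k). Qed.

Lemma eval_over_le (R : realType) (X : Type) (z : nat -> X -> R)
    (W : nat -> dyadic) (N : nat) (t : dyadic) (x : X) (e : R) :
  (forall i, (N <= i)%N -> `|dyadic_eval z (W i) x| <= e) ->
  dyadic_over W N t -> `|dyadic_eval z t x| <= e.
Proof.
move=> We; elim=> [i /We//|b t1 t2 _ IH1 _ IH2] /=.
rewrite normrM [`|2^-1|]ger0_norm ?invr_ge0// ler_pdivrMr//.
rewrite (le_trans (ler_normD _ _))// normrM normrX normrN1 expr1n mul1r.
by rewrite mulr_natr mulr2n lerD.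
Qed.

Definition pair_blocks (b : bool) (V : nat -> dyadic) (k : nat) :=
  Node b (V k.*2) (V k.*2.+1).

Lemma pair_blocks_disjoint b V : disjoint_blocks V -> disjoint_blocks (pair_blocks b V).
Proof.
move=> [uV dV]; split=> [k|k l kl j] /=.
  rewrite cat_uniq !uV /= andbT; apply/hasPn => j; apply: dV; lia.
rewrite !mem_cat => jk; apply/negP => jl.
by case/orP: jk => jk; case/orP: jl => jl; move: jl; apply/negP;
  apply: dV jk; lia.
Qed.

Lemma pair_blocks_of b V : blocks_of V (pair_blocks b V).
Proof. by move=> k; apply: Over_node; apply: Over_leaf; lia. Qed.

Lemma subseq_blocks_disjoint (phi : nat -> nat) V : injective phi ->
  disjoint_blocks V -> disjoint_blocks (V \o phi).
Proof. by move=> phiI [uV dV]; split=> [k|k l kl] /=; [|apply: dV => /phiI]. Qed.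

Lemma subseq_blocks_of (phi : nat -> nat) V : (forall k, (k <= phi k)%N) ->
  blocks_of V (V \o phi).
Proof. by move=> phik k; exact: Over_leaf. Qed.

End Blocks.

(** * Sequences of functions tending to zero pointwise *)

Lemma ultra_cluster_cvg (T : Type) (S : topologicalType) (U : set_system T)
    (f : T -> S) (l : S) : UltraFilter U -> cluster (f @ U) l -> f @ U --> l.
Proof.
move=> UU cl A /= lA; have [//|UnA] := in_ultra_setVsetC (f @^-1` A) UU.
by have [s [/= nAs As]] := cl (~` A) A UnA lA.
Qed.

Lemma ultra_bounded_cvg (R : realType) (T : Type) (U : set_system T)
    (f : T -> R) (M : R) :
  UltraFilter U -> U [set t | `|f t| <= M] -> cvg (f @ U).
Proof.
move=> UU UM.
have [|l [_ cl]] := @segment_compact R (- M) M (f @ U).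
- by move: UM; apply: (@filterS _ U) => t /=; rewrite ler_norml in_itv.
- by apply/cvg_ex; exists l; exact: ultra_cluster_cvg.
Qed.

Lemma ultra_nat : exists U : set_system nat, UltraFilter U /\ \oo `<=` U.
Proof. exact: ultraFilterLemma. Qed.

Lemma cvg_ord_sum (K : numFieldType) (V : normedModType K) (T : Type)
    (F : set_system T) (f : nat -> T -> V) (l : nat -> V) (n : nat) :
  Filter F -> (forall i, f i @ F --> l i) ->
  (fun t => \sum_(i < n) f i t) @ F --> \sum_(i < n) l i.
Proof.
move=> FF fl; elim: n => [|n IH].
  by under eq_fun do rewrite big_ord0; rewrite big_ord0; exact: cvg_cst.
by under eq_fun do rewrite big_ord_recr; rewrite big_ord_recr /=; exact: cvgD.
Qed.

Lemma bounded_square_sum_cvg0 (R : realType) (a : nat -> R) (M : R) :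
  (forall N, \sum_(n < N) a n ^+ 2 <= M) -> a @ \oo --> (0 : R).
Proof.
move=> aM.
have c : cvgn (series (fun n => a n ^+ 2)).
  apply: nondecreasing_is_cvgn.
    apply/nondecreasing_seqP => n; rewrite /series /= big_nat_recr//=.
    by rewrite lerDl sqr_ge0.
  by exists M => _ [n _ <-]; rewrite /series /= big_mkord.
have /cvgrPdist_lt a20 := cvg_series_cvg_0 c.
apply/cvgrPdist_lt => e e0; have e20 : 0 < e ^+ 2 by rewrite exprn_gt0.
apply: filterS (a20 _ e20) => n; rewrite !sub0r !normrN ger0_norm ?sqr_ge0// => ae.
by rewrite -(@ltr_pXn2r _ 2)// ?nnegrE ?ltW// -normrX ger0_norm ?sqr_ge0.
Qed.

(** * Null sequences in an absolutely convex set [L] closed under pointwise limits, as a dual ball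
    is *)

Section JosefsonNissenzweig.
Context {R : realType} {X : Type} (B : set X) (L : set (X -> R)).
Hypothesis L_le1 : forall f, L f -> forall x, B x -> `|f x| <= 1.
Hypothesis L_comb : forall f g (a b : R), L f -> L g -> `|a| + `|b| <= 1 ->
  L (fun x => a * f x + b * g x).
Hypothesis L_lim : forall (U : set_system nat) (F : nat -> X -> R) (l : X -> R),
  UltraFilter U -> (forall n, L (F n)) ->
  (forall x, (fun n => F n x) @ U --> l x) -> L l.
Hypothesis L_bounded : forall x, exists M : R, forall f, L f -> `|f x| <= M.

Lemma half_norm2 : `|2^-1 : R| + `|2^-1 : R| <= 1.
Proof. by rewrite ger0_norm ?invr_ge0//; lra. Qed.

Section Blocks.
Context (z : nat -> X -> R) (Lz : forall n, L (z n)).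

Lemma L_eval (t : dyadic) : L (dyadic_eval z t).
Proof.
elim: t => [n|b t1 IH1 t2 IH2] /=; first exact: Lz.
have -> : (fun x => (dyadic_eval z t1 x + (-1) ^+ b * dyadic_eval z t2 x) / 2) =
    (fun x => 2^-1 * dyadic_eval z t1 x + (2^-1 * (-1) ^+ b) * dyadic_eval z t2 x).
  by apply/funext => x; ring.
by apply: L_comb => //; rewrite normrM normrX normrN1 expr1n mulr1; exact: half_norm2.
Qed.

(** Stage [j] passes to blocks eventually below [1/(j+1)] at each point. From index [j+1] on, the
    diagonal consists of blocks over [W j.+1], so it inherits every one of these bounds. *)
Lemma null_diagonal :
  (forall (W : nat -> dyadic) (e : R), disjoint_blocks W -> 0 < e ->
    exists V, [/\ disjoint_blocks V, blocks_of W V & forall x, B x ->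
      exists N, forall k, (N <= k)%N -> `|dyadic_eval z (V k) x| <= e]) ->
  exists d : nat -> dyadic, (forall k, uniq (leaves (d k))) /\
    forall x, B x -> (fun k => dyadic_eval z (d k) x) @ \oo --> (0 : R).
Proof.
move=> small.
pose Q (j : nat) (W V : nat -> dyadic) := blocks_of W V /\ forall x, B x ->
  exists N, forall k, (N <= k)%N -> `|dyadic_eval z (V k) x| <= j.+1%:R^-1.
have [|j W dW|W [_ dW WQ]] :=
    @invariant_choice _ (fun _ => disjoint_blocks) Q Leaf.
- split=> // k l kl j /=; rewrite !inE => /eqP ->; exact/eqP.
- have [V [dV WV Ve]] := small W (j.+1%:R^-1) dW ltac:(by rewrite invr_gt0).
  by exists V.
exists (fun k => W k k); split=> [k|x Bx]; first exact: (dW k).1.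
have Wle j k : (j <= k)%N -> blocks_of (W j) (W k).
  move=> jk; rewrite -(subnK jk); elim: (k - j)%N => [|d IH].
    exact: blocks_of_refl.
  by rewrite addSn; apply: blocks_of_trans IH _; exact: (WQ _).1.
apply/cvgrPdist_le => e e0.
have [j je] : exists j, j.+1%:R^-1 <= e :> R.
  exists (Num.bound e^-1); rewrite -[leRHS]invrK lef_pV2 ?posrE ?invr_gt0//.
  apply: ltW; apply: lt_le_trans (archi_boundP _) _; first by rewrite invr_ge0 ltW.
  by rewrite ler_nat.
have [N NP] := (WQ j).2 x Bx.
exists (maxn N j.+1) => // k /=; rewrite geq_max => /andP[Nk jk].
rewrite sub0r normrN; apply: le_trans je.
apply: (@eval_over_le _ _ z (W j.+1) N).
  exact: NP.
exact: dyadic_over_le Nk (Wle _ _ jk k).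
Qed.

Context (W : nat -> dyadic) (theta : R).
Hypothesis dW : disjoint_blocks W.
Hypothesis theta_gt0 : 0 < theta.
Hypothesis large : forall V, disjoint_blocks V -> blocks_of W V ->
  exists2 x, B x & unbounded [set k | theta < `|dyadic_eval z (V k) x|].

(* In a state t at level m, t.1 is the current block sequence and t.2 n k is
   the half difference recorded at level n, averaged over all the pairs merged
   since then into the k-th block. *)
Let state := ((nat -> dyadic) * (nat -> nat -> X -> R))%type.

Let bessel (m : nat) (t : state) := [/\ disjoint_blocks t.1, blocks_of W t.1,
  forall n k, L (t.2 n k) &
  forall k x, B x -> dyadic_eval z (t.1 k) x ^+ 2 + \sum_(n < m) t.2 n k x ^+ 2 <= 1].

(** The new record is bounded below at one point uniformly in [k], and other records are only
    averaged; hence lower bounds at earlier points persist. *)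
Let halving (m : nat) (t t' : state) :=
  (exists2 x, B x & forall k, theta <= t'.2 m k x) /\
  exists k1 k2 : nat -> nat, forall n k, n <> m ->
    t'.2 n k = (fun x => 2^-1 * t.2 n (k1 k) x + 2^-1 * t.2 n (k2 k) x).

(** The half differences of consecutive pairs are again disjoint blocks of [W], so [large] gives a
    point [x0] where infinitely many exceed [theta] in absolute value. Only those pairs are kept,
    through [phi]. *)
Lemma halving_step m t : bessel m t -> exists t', bessel m.+1 t' /\ halving m t t'.
Proof.
case: t => V c [/= dV WV Lc Vc].
have dV1 := pair_blocks_disjoint true dV.
have WV1 := blocks_of_trans WV (pair_blocks_of true V).
have [x0 Bx0 ux0] := large dV1 WV1.
have [phi [phii phiP]] := unbounded_enum (fun=> ux0).
have phik := increasing_ge phii.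
have phiI : injective phi.
  move=> i j ij; apply/eqP; rewrite eqn_leq; apply/andP; split; rewrite leqNgt;
  apply/negP => /(homo_ltn ltn_trans phii); rewrite ij ltnn//.
(* The sign turns a large absolute value at [x0] into a lower bound, which survives averaging. *)
pose s k : R := Num.sg (dyadic_eval z (pair_blocks true V (phi k)) x0).
pose V' := pair_blocks false V \o phi.
pose c' n k := if n == m then
    fun x => (s k / 2) * dyadic_eval z (V (phi k).*2) x
      + (- (s k / 2)) * dyadic_eval z (V (phi k).*2.+1) x
  else fun x => 2^-1 * c n (phi k).*2 x + 2^-1 * c n (phi k).*2.+1 x.
have s1 k : `|s k| <= 1 by rewrite /s normr_sg; case: (_ != _).
have s2 k : s k ^+ 2 <= 1 by rewrite -[s k ^+ 2]ger0_norm ?sqr_ge0// normrX expr_le1.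
exists (V', c'); split; first split => /=.
- by apply: subseq_blocks_disjoint => //; exact: pair_blocks_disjoint.
- by apply: blocks_of_trans (subseq_blocks_of _ _) => //;
    apply: blocks_of_trans WV (pair_blocks_of _ _).
- move=> n k; rewrite /c'; case: eqP => _; apply: L_comb; rewrite ?half_norm2//;
    try exact: L_eval.
  rewrite normrN normrM [`|2^-1|]ger0_norm ?invr_ge0//; have := s1 k; lra.
- move=> k x Bx; rewrite big_ord_recr /= expr0 mul1r.
  have -> : \sum_(n < m) c' n k x ^+ 2 =
      \sum_(n < m) (2^-1 * c n (phi k).*2 x + 2^-1 * c n (phi k).*2.+1 x) ^+ 2.
    by apply: eq_bigr => n _; rewrite /c' ltn_eqF.
  rewrite /c' eqxx.
  set a := dyadic_eval z (V (phi k).*2) x; set b := dyadic_eval z (V (phi k).*2.+1) x.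
  have Va := Vc (phi k).*2 x Bx; have Vb := Vc (phi k).*2.+1 x Bx.
  (* Convexity of the square bounds the averaged records. With the parallelogram identity below, the
     new sum is at most the mean of the sums of the two merged blocks. *)
  have sumle : \sum_(n < m) (2^-1 * c n (phi k).*2 x + 2^-1 * c n (phi k).*2.+1 x) ^+ 2
      <= (\sum_(n < m) c n (phi k).*2 x ^+ 2 + \sum_(n < m) c n (phi k).*2.+1 x ^+ 2) / 2.
    rewrite -big_split mulr_suml; apply: ler_sum => n _ /=; rewrite -subr_ge0.
    set u := c n _ x; set v := c n _ x.
    by rewrite [leRHS](_ : _ = ((u - v) / 2) ^+ 2) ?sqr_ge0//; field.
  have sle : (s k / 2 * a + - (s k / 2) * b) ^+ 2 <= ((a - b) / 2) ^+ 2.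
    rewrite [leLHS](_ : _ = s k ^+ 2 * ((a - b) / 2) ^+ 2); last by ring.
    by rewrite ler_piMl ?sqr_ge0.
  move: Va Vb; rewrite -/a -/b => Va Vb.
  have : ((a + b) / 2) ^+ 2 + ((a - b) / 2) ^+ 2 = (a ^+ 2 + b ^+ 2) / 2 by field.
  lra.
- split; last first.
    by exists (fun k => (phi k).*2), (fun k => (phi k).*2.+1) => n k /eqP/negbTE nm;
      rewrite /= /c' nm.
  exists x0 => // k; rewrite /= /c' eqxx.
  rewrite (_ : _ + _ = `|dyadic_eval z (pair_blocks true V (phi k)) x0|).
    exact: ltW (phiP k).
  by rewrite normrEsg -/(s k) /= expr1; field.
Qed.

Lemma null_bessel : exists f : nat -> X -> R, [/\ forall n, L (f n),
    forall x, B x -> (fun n => f n x) @ \oo --> (0 : R) &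
    forall n, exists2 x, B x & theta <= `|f n x|].
Proof.
(* At level 0 no record enters the sum, and [z 0] is a placeholder lying in [L]. *)
have [|m t /halving_step//|t [_ tb th]] :=
    @invariant_choice state bessel halving (W, fun _ _ => z 0%N).
- split=> //=; first exact: blocks_of_refl.
  move=> k x Bx; rewrite big_ord0 addr0 -[_ ^+ 2]ger0_norm ?sqr_ge0// normrX.
  by rewrite expr_le1//; exact: L_le1 (L_eval _) _ Bx.
have /choice[x xP] m : exists x, B x /\ forall k, theta <= (t m.+1).2 m k x.
  by have [[x Bx xm] _] := th m; exists x.
(* The [n]-th record is made in passing to state [n.+1]; later stages average it, which keeps the
   lower bound at [x n]. *)
have tx n d k : theta <= (t (n.+1 + d)%N).2 n k (x n).
  elim: d k => [|d IH] k; first by rewrite addn0; exact: (xP n).2.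
  have [_ [k1 [k2 E]]] := th (n.+1 + d)%N.
  rewrite addnS E; last lia.
  have := IH (k1 k); have := IH (k2 k); lra.
have [U [UU oU]] := ultra_nat.
have Lt m n k : L ((t m).2 n k) by have [_ _ + _] := tb m.
have cv n w : cvg ((fun m => (t m).2 n 0%N w) @ U).
  have [M MP] := L_bounded w; apply: (@ultra_bounded_cvg _ _ _ _ M).
  by apply: filterE => m /=; exact: MP.
pose f n w := lim ((fun m => (t m).2 n 0%N w) @ U).
exists f; split.
- by move=> n; apply: (L_lim (F := fun m => (t m).2 n 0%N)) => // w; exact: cv.
- move=> w Bw; apply: (@bounded_square_sum_cvg0 _ _ 1) => N.
  have fN : (fun m => \sum_(n < N) (t m).2 n 0%N w ^+ 2) @ U --> \sum_(n < N) f n w ^+ 2.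
    apply: (cvg_ord_sum (f := fun n m => (t m).2 n 0%N w ^+ 2)
      (l := fun n => f n w ^+ 2)) => n; rewrite expr2; under eq_fun do rewrite expr2.
    by apply: cvgM; exact: cv.
  apply: (cvg_le (F := U) fN (cvg_cst (1 : R))).
  apply: oU; exists N => // m /= Nm.
  have [_ _ _ /(_ 0%N w Bw)] := tb m; apply: le_trans.
  rewrite -(subnKC Nm) big_split_ord /= -[leLHS]add0r lerD ?sqr_ge0// lerDl.
  by apply: sumr_ge0 => i _; exact: sqr_ge0.
- move=> n; exists (x n); first exact: (xP n).1.
  apply: le_trans (ler_norm _).
  apply: (cvg_le (F := U) (cvg_cst theta) (cv n (x n))).
  by apply: oU; exists n.+1 => // m /= nm; rewrite -(subnKC nm).
Qed.

End Blocks.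

(** In the convergent case, half differences of consecutive terms work with [delta / 2]. In the
    independent case, either some [W] feeds [null_bessel], or [null_diagonal] applies and
    independence bounds the averages below. *)
Lemma null_sequence (y : nat -> X -> R) (delta : R) : (forall n, L (y n)) ->
  0 < delta ->
  (forall m n, (m < n)%N -> exists2 x, B x & delta <= `|y m x - y n x|) ->
  exists (f : nat -> X -> R) (e : R), [/\ 0 < e, forall n, L (f n),
    forall x, B x -> (fun n => f n x) @ \oo --> (0 : R) &
    forall n, exists2 x, B x & e <= `|f n x|].
Proof.
move=> Ly d0 sep.
have [|[n [ni cv]]|[p [q [n [pq ind]]]]] := @cvg_or_independent _ _ B y 1.
- by move=> n x Bx; exact: L_le1 (Ly n) _ Bx.
- exists (fun k x => 2^-1 * y (n k) x + (- 2^-1) * y (n k.+1) x), (delta / 2); split.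
  + by rewrite divr_gt0.
  + by move=> k; apply: L_comb => //; rewrite normrN half_norm2.
  + move=> x /cv cx.
    have : (fun k => 2^-1 * y (n k) x + (- 2^-1) * y (n k.+1) x) @ \oo -->
        2^-1 * limn (fun k => y (n k) x) + (- 2^-1) * limn (fun k => y (n k) x).
      apply: cvgD; apply: cvgMr => //.
      by move: cx; rewrite -(@cvg_shiftS _ (fun k => y (n k) x)).
    by rewrite mulNr subrr.
  + move=> k; have [x Bx xP] := sep _ _ (ni k); exists x => //.
    rewrite mulNr -mulrBr normrM ger0_norm ?invr_ge0//; lra.
pose z k := y (n k).
have Lz k : L (z k) by exact: Ly.
have lb : forall t, uniq (leaves t) -> exists2 x, B x & (q - p) / 2 <= `|dyadic_eval z t x|.
  exact: eval_lower_bound ind.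
have [[W [th [dW th0 WP]]]|nW] := pselect (exists (W : nat -> dyadic) (theta : R),
    [/\ disjoint_blocks W, 0 < theta & forall V, disjoint_blocks V -> blocks_of W V ->
      exists2 x, B x & unbounded [set k | theta < `|dyadic_eval z (V k) x|]]).
  by have [f [Lf f0 fth]] := null_bessel Lz dW th0 WP; exists f, th.
have [W e dW e0|d [ud dP]] := null_diagonal (z := z).
  apply: contrapT => nV; apply: nW; exists W, e; split=> // V dV WV.
  apply: contrapT => nx; apply: nV; exists V; split=> // x Bx.
  have [N NP] := not_unbounded (contra_not (fun u => ex_intro2 _ _ x Bx u) nx).
  by exists N => k /NP /negP; rewrite -leNgt.
exists (fun k => dyadic_eval z (d k)), ((q - p) / 2); split=> //.
- by rewrite divr_gt0// subr_gt0.
- by move=> k; exact: L_eval.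
- by move=> k; exact: lb.
Qed.

End JosefsonNissenzweig.

(** * The Hahn-Banach theorem *)

Section HahnBanach.
Context {R : realType} {K : numFieldType} (iota : {rmorphism R -> K}).
Context {V : lmodType K}.

(** Homogeneity is required for nonnegative reals only, through [iota], so real and complex spaces
    are treated together. *)
Definition sublinear (p : V -> R) :=
  (forall x y, p (x + y) <= p x + p y) /\
  (forall r x, 0 <= r -> p (iota r *: x) = r * p x).

Lemma sublinear0 p : sublinear p -> p 0 = 0.
Proof. by move=> [_ /(_ 0 0 (lexx _))]; rewrite scaler0 mul0r. Qed.

Lemma sublinear_ge p x : sublinear p -> - p (- x) <= p x.
Proof.
move=> sp; have := sp.1 x (- x); rewrite subrr sublinear0//; lra.
Qed.

Lemma sublinearP p : (forall x y, p (x + y) <= p x + p y) -> p 0 = 0 ->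
  (forall r x, 0 < r -> p (iota r *: x) <= r * p x) -> sublinear p.
Proof.
move=> pD p0 pZ; split=> // r x; rewrite le_eqVlt => /predU1P[<-|r0].
  by rewrite rmorph0 scale0r p0 mul0r.
apply/eqP; rewrite eq_le pZ//= mulrC -ler_pdivlMr// mulrC.
have rI : 0 < r^-1 by rewrite invr_gt0.
apply: le_trans (pZ _ _ rI); rewrite scalerA -rmorphM mulVf ?gt_eqF//.
by rewrite rmorph1 scale1r.
Qed.

(* A minimal sublinear q coincides with all its shifts, so that
   q x <= q (x + a) - q a: it is additive. *)
Definition shift_sublinear (p : V -> R) (a x : V) : R :=
  inf [set p (x + iota t *: a) - t * p a | t in [set t | 0 <= t]].

Section Shift.
Context (p : V -> R) (a : V) (sp : sublinear p).

Let S x := [set p (x + iota t *: a) - t * p a | t in [set t | 0 <= t]].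

Lemma has_inf_shift_sublinear x : has_inf (S x).
Proof.
split; first by exists (p (x + iota 0 *: a) - 0 * p a), 0 => /=.
exists (- p (- x)) => _ [t /= t0 <-]; rewrite -(sp.2 t a)//.
have := sp.1 (x + iota t *: a) (- x); rewrite addrAC subrr add0r; lra.
Qed.

Lemma shift_sublinear_le t x : 0 <= t ->
  shift_sublinear p a x <= p (x + iota t *: a) - t * p a.
Proof.
by move=> t0; apply: (inf_lbound (has_inf_shift_sublinear x).2); exists t.
Qed.

Lemma shift_sublinear_sublinear : sublinear (shift_sublinear p a).
Proof.
apply: sublinearP => [x y||r x r0].
- rewrite -[_ + shift_sublinear p a y]opprK lerNr; apply: contraT; rewrite -ltNge => h.
  exfalso; pose e := shift_sublinear p a (x + y) -
    (shift_sublinear p a x + shift_sublinear p a y).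
  have e0 : 0 < e / 2 by rewrite /e; lra.
  have [_ [t /= t0 <-] ht] := inf_adherent e0 (has_inf_shift_sublinear x).
  have [_ [s /= s0 <-] hs] := inf_adherent e0 (has_inf_shift_sublinear y).
  have := shift_sublinear_le (x + y) (addr_ge0 t0 s0).
  have := sp.1 (x + iota t *: a) (y + iota s *: a).
  rewrite addrACA -scalerDl -rmorphD.
  move: ht hs; rewrite -!/(shift_sublinear _ _ _) /e; lra.
- apply/eqP; rewrite eq_le; apply/andP; split.
    have := shift_sublinear_le 0 (lexx 0).
    by rewrite rmorph0 scale0r addr0 mul0r subr0 (sublinear0 sp).
  apply: lb_le_inf; first exact: (has_inf_shift_sublinear 0).1.
  by move=> _ [t /= t0 <-]; rewrite add0r sp.2// subrr.
- rewrite mulrC -ler_pdivrMr//.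
  apply: lb_le_inf; first exact: (has_inf_shift_sublinear x).1.
  move=> _ [t /= t0 <-]; rewrite ler_pdivrMr//.
  have rt : 0 <= r * t by rewrite mulr_ge0// ltW.
  apply: le_trans (shift_sublinear_le _ rt) _.
  rewrite rmorphM -scalerA -scalerDr (sp.2 _ _ (ltW r0)); lra.
Qed.

End Shift.

(** Zorn's lemma: a chain is bounded below by its pointwise infimum, which is finite because
    [- p (- x) <= q x] for every [q] below [p]. *)
Lemma minimal_sublinear p : sublinear p -> exists q, [/\ sublinear q,
  forall x, q x <= p x & forall q', sublinear q' -> (forall x, q' x <= q x) -> q' = q].
Proof.
move=> sp.
pose dom q := sublinear q /\ forall x, q x <= p x.
pose T := {q : V -> R | dom q}.
pose r (q1 q2 : T) := `[< forall x, sval q2 x <= sval q1 x >].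
have [|q1 q2 q3 /asboolP h12 /asboolP h23|q1 q2 /asboolP h12 /asboolP h21|A Atot|
    [q [sq qp]] qmin] := @Zorn T r.
- by move=> q; apply/asboolP.
- by apply/asboolP => x; exact: le_trans (h23 x) (h12 x).
- case: q1 q2 h12 h21 => [q1 s1] [q2 s2] /= h12 h21; apply: eq_exist.
  by apply/funext => x; apply/eqP; rewrite eq_le h21 h12.
- have [[q0 Aq0]|A0] := pselect (exists q, A q); last first.
    by exists (exist dom p (conj sp (fun=> lexx _))) => q Aq; case: A0; exists q.
  pose S x := [set sval q x | q in A].
  have hS x : has_inf (S x).
    split; first by exists (sval q0 x), q0.
    exists (- p (- x)) => _ [q Aq <-]; have [sq qp] := svalP q.
    by have := sublinear_ge x sq; have := qp (- x); lra.
  have Sle x q : A q -> inf (S x) <= sval q x.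
    by move=> Aq; apply: (inf_lbound (hS x).2); exists q.
  have sS : sublinear (fun x => inf (S x)).
    apply: sublinearP => [x y||t x t0].
    + rewrite leNgt; apply/negP => h.
      pose e := inf (S (x + y)) - (inf (S x) + inf (S y)).
      have e0 : 0 < e / 2 by rewrite /e; lra.
      have [_ [q1 Aq1 <-] h1] := inf_adherent e0 (hS x).
      have [_ [q2 Aq2 <-] h2] := inf_adherent e0 (hS y).
      (* In a chain the smaller of the two functionals is nearly optimal at both points. *)
      have [q [Aq qq1 qq2]] : exists q, [/\ A q, sval q x <= sval q1 x &
          sval q y <= sval q2 y].
        have [/asboolP q12|/asboolP q21] := Atot _ _ Aq1 Aq2.
        - by exists q2; split.
        - by exists q1; split.
      have := Sle (x + y) q Aq; have := (svalP q).1.1 x y; rewrite /e in h1 h2; lra.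
    + apply/eqP; rewrite eq_le; apply/andP; split.
        by have := Sle 0 q0 Aq0; rewrite (sublinear0 (svalP q0).1).
      apply: lb_le_inf; first exact: (hS 0).1.
      by move=> _ [q Aq <-]; rewrite (sublinear0 (svalP q).1).
    + rewrite mulrC -ler_pdivrMr//; apply: lb_le_inf; first exact: (hS x).1.
      move=> _ [q Aq <-]; rewrite ler_pdivrMr// mulrC -((svalP q).1.2 _ _ (ltW t0)).
      exact: Sle.
  have Sp x : inf (S x) <= p x by apply: le_trans (Sle x q0 Aq0) _; exact: (svalP q0).2.
  by exists (exist dom _ (conj sS Sp)) => q Aq; apply/asboolP => x /=; exact: Sle.
- exists q; split=> // q' sq' q'q.
  have q'p x : q' x <= p x by exact: le_trans (q'q x) (qp x).
  have := qmin (exist dom q' (conj sq' q'p)).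
  by move=> /(_ (asboolT _))-/(_ q'q)/(congr1 sval).
Qed.

(** A minimal functional below the shift of [p] along [x0] is linear. The shift is at most [- p x0]
    at [- x0], as the parameter 1 shows, and this forces equality at [x0]. *)
Lemma hahn_banach p x0 : sublinear p -> exists f : V -> R,
  [/\ forall x y, f (x + y) = f x + f y, forall r x, f (iota r *: x) = r * f x,
   forall x, f x <= p x & f x0 = p x0].
Proof.
move=> sp.
have [f [sf fp fmin]] := minimal_sublinear (shift_sublinear_sublinear x0 sp).
have ple q a x : sublinear q -> shift_sublinear q a x <= q x.
  move=> sq; have := shift_sublinear_le a sq x (lexx 0).
  by rewrite rmorph0 scale0r addr0 mul0r subr0.
have fD x y : f (x + y) = f x + f y.
  apply/eqP; rewrite eq_le sf.1/=.
  rewrite -{1}(fmin _ (shift_sublinear_sublinear y sf) (fun x => ple f y x sf)).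
  have := shift_sublinear_le y sf x ler01.
  rewrite rmorph1 scale1r mul1r; lra.
have fN x : f (- x) = - f x.
  by apply/eqP; rewrite -subr_eq0 opprK -fD addNr sublinear0.
have fx0 : f x0 = p x0.
  apply/eqP; rewrite eq_le (le_trans (fp _) (ple _ _ _ sp))/=.
  have := fp (- x0); rewrite fN; have := shift_sublinear_le x0 sp (- x0) ler01.
  rewrite rmorph1 scale1r addNr sublinear0//; lra.
exists f; split=> //.
- move=> r x; have [r0|/ltW r0] := leP 0 r; first exact: sf.2.
  by rewrite -[r]opprK rmorphN scaleNr fN sf.2 ?oppr_ge0//; ring.
- by move=> x; exact: le_trans (fp x) (ple _ _ _ sp).
Qed.

End HahnBanach.

(** * Real and complex scalars, and functionals obtained from their real parts *)

Section Scalars.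
Context {R : realType}.

Definition scalar_of_real k : {rmorphism R -> scalars R k} :=
  match k return {rmorphism R -> scalars R k} with
  | real_scalars => idfun
  | complex_scalars => @real_complex R
  end.

Definition real_part k : scalars R k -> R :=
  match k return scalars R k -> R with
  | real_scalars => id
  | complex_scalars => @complex.Re R
  end.

End Scalars.

Lemma linear_of_fun (K : nzRingType) (U V : lmodType K) (f : U -> V) :
  linear f -> exists F : {linear U -> V}, F =1 f.
Proof.
move=> lf; pose m := GRing.isLinear.Build K U V *:%R f lf.
by exists (HB.pack_for {linear U -> V} f m).
Qed.

Section ScalarTheory.
Context {R : realType} {k : scalar_kind}.
Local Notation K := (scalars R k).
Local Notation iota := (@scalar_of_real R k).
Local Notation re := (@real_part R k).

Lemma real_partD (z w : K) : re (z + w) = re z + re w.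
Proof. by case: k z w => // -[? ?] [? ?]. Qed.

Lemma real_partN (z : K) : re (- z) = - re z.
Proof. by case: k z => // -[? ?]. Qed.

Lemma scalar_of_realK (r : R) : re (iota r) = r.
Proof. by case: k. Qed.

Lemma real_partM (r : R) (z : K) : re (iota r * z) = r * re z.
Proof. by case: k z => // -[a b] /=; rewrite mul0r subr0. Qed.

Lemma ler_scalar (r s : R) : (iota r <= iota s) = (r <= s).
Proof. by case: k => //=; rewrite lecR. Qed.

Lemma ltr_scalar (r s : R) : (iota r < iota s) = (r < s).
Proof. by case: k => //=; rewrite ltcR. Qed.

Lemma real_partK (z : K) : 0 <= z -> iota (re z) = z.
Proof. by case: k z => //= z z0; rewrite RRe_real// ger0_real. Qed.

Lemma norm_real_part (z : K) : `|iota (re z)| <= `|z|.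
Proof.
case: k z => //= z; rewrite normc_def /= normc_def lecR /=.
by rewrite ler_sqrt ?addr_ge0 ?sqr_ge0// expr0n addr0 lerDl sqr_ge0.
Qed.

(** A uniform version of [z = Re z - i Re (i z)]; over the reals, [c = 0] removes the second
    term. *)
Lemma scalar_decomposition : exists j c : K, [/\ `|j| = 1, `|c| <= 1 &
  forall z, z = iota (re z) + c * iota (re (j * z))].
Proof.
case: k => /=.
  by exists 1, 0; rewrite normr1 normr0 ler01; split=> // z; rewrite mul0r addr0.
exists 'i%C, (- 'i)%C; rewrite normrN normc_def /= expr0n expr1n add0r sqrtr1.
split=> // -[a b]; apply/eqP; rewrite eq_complex /=.
by rewrite !(mul0r,mulr0,mul1r,mulN1r,add0r,addr0,subr0,sub0r,opprK,oppr0) !eqxx.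
Qed.

Lemma rotate_to_norm (z : K) : exists2 w : K, `|w| = 1 & w * z = `|z|.
Proof.
have [->|z0] := eqVneq z 0; first by exists 1; rewrite ?normr1 ?normr0 ?mulr0.
exists (`|z| / z); last by rewrite mulfVK.
by rewrite normrM normr_id normfV divff// normr_eq0.
Qed.

Lemma scalar_archimedean (e : K) : 0 < e -> exists n : nat, n.+1%:R^-1 < e.
Proof.
move=> e0; have re0 : 0 < re e by rewrite -ltr_scalar real_partK ?ltW// rmorph0.
exists (Num.bound (re e)^-1).
rewrite -[ltRHS](real_partK (ltW e0)) -(rmorph_nat iota) -fmorphV ltr_scalar.
rewrite -[ltRHS]invrK ltf_pV2 ?posrE ?invr_gt0//.
apply: lt_trans (archi_boundP _) _; first by rewrite invr_ge0 ltW.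
by rewrite ltr_nat.
Qed.

Section RealNorm.
Context {X : normedModType K}.

(** The norm takes values in [K]; its real copy gives access to infima and to real linear
    arithmetic. *)
Definition rnorm (x : X) : R := re `|x|.

Lemma rnormE (x : X) : iota (rnorm x) = `|x|.
Proof. exact: real_partK (normr_ge0 x). Qed.

Lemma rnorm_le (x : X) (r : R) : (rnorm x <= r) = (`|x| <= iota r).
Proof. by rewrite -rnormE ler_scalar. Qed.

Lemma rnorm_lt (x : X) (r : R) : (rnorm x < r) = (`|x| < iota r).
Proof. by rewrite -rnormE ltr_scalar. Qed.

Lemma rnorm_ge0 (x : X) : 0 <= rnorm x.
Proof. by rewrite -ler_scalar rnormE rmorph0. Qed.

Lemma rnorm0 : rnorm 0 = 0.
Proof. by rewrite /rnorm normr0 -[X in re X](rmorph0 iota) scalar_of_realK. Qed.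

Lemma rnormN (x : X) : rnorm (- x) = rnorm x.
Proof. by rewrite /rnorm normrN. Qed.

Lemma rdistC (x y : X) : rnorm (x - y) = rnorm (y - x).
Proof. by rewrite /rnorm distrC. Qed.

Lemma rnormD (x y : X) : rnorm (x + y) <= rnorm x + rnorm y.
Proof. by rewrite rnorm_le rmorphD !rnormE ler_normD. Qed.

Lemma rnormZ (a : K) (x : X) : rnorm (a *: x) = re `|a| * rnorm x.
Proof. by rewrite -real_partM real_partK// /rnorm normrZ. Qed.

Lemma rnorm_gt0 (x : X) : (0 < rnorm x) = (x != 0).
Proof. by rewrite -ltr_scalar rnormE rmorph0 normr_gt0. Qed.

Lemma norm_scalar (r : R) : 0 <= r -> re `|iota r| = r.
Proof.
by move=> r0; rewrite ger0_norm ?scalar_of_realK// -(rmorph0 iota) ler_scalar.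
Qed.

(** In the complex case [F x = f x - i f (i x)]. Rotating [x] until [F] takes a nonnegative value
    turns the one-sided bound on [f] into a bound on [|F x|]. *)
Lemma complexify (f : X -> R) : (forall x y, f (x + y) = f x + f y) ->
  (forall r x, f (iota r *: x) = r * f x) -> (forall x, f x <= rnorm x) ->
  exists F : {linear X -> K^o}, (forall x, re (F x) = f x) /\
    forall x, `|F x| <= `|x|.
Proof.
move=> fD fZ fle.
suff [F ref] : exists F : {linear X -> K^o}, forall x, re (F x) = f x.
  exists F; split=> // x; have [w w1 wF] := rotate_to_norm (F x).
  have -> : `|F x| = iota (f (w *: x)).
    by rewrite -ref linearZ /= -(real_partK (normr_ge0 (F x))) -wF.
  by rewrite -[leRHS]mul1r -w1 -normrZ -rnormE ler_scalar.
clear fle; case: k X f fD fZ => /= Y f fD fZ.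
  by have [|F Ff] := @linear_of_fun _ Y _ (f : Y -> R^o); [move=> a x y; rewrite fD fZ|exists F].
have [|F Ff] := @linear_of_fun _ Y _ (fun x => (f x +i* - f ('i%C *: x))%C : R[i]^o).
  move=> [a b] x y; rewrite !scalerDr !scalerA.
  have ab : (a +i* b)%C = a%:C%C + b%:C%C * 'i%C.
    by apply/eqP; rewrite eq_complex /= !(mul0r,mulr0,mulr1,subr0,addr0,add0r) !eqxx.
  have iab : 'i%C * (a +i* b)%C = (- b)%:C%C + a%:C%C * 'i%C.
    by apply/eqP; rewrite eq_complex /= !(mul0r,mulr0,mulr1,mul1r,subr0,sub0r,addr0,add0r) !eqxx.
  have fab u v z : f ((u%:C%C + v%:C%C * 'i%C) *: z) = u * f z + v * f ('i%C *: z).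
    by rewrite scalerDl -scalerA fD !fZ.
  rewrite iab ab !fD !fab; apply/eqP; rewrite eq_complex /=; apply/andP; split;
    apply/eqP; ring.
by exists F => x; rewrite Ff.
Qed.

(** The distance to [E] is a sublinear functional that is at most 0 on [E]; the Hahn-Banach theorem
    is applied to it at [x0]. *)
Lemma functional_separation (E : set X) (x0 : X) (d : R) : E 0 ->
  (forall a x y, E x -> E y -> E (a *: x + y)) ->
  (forall e, E e -> d <= rnorm (x0 - e)) ->
  exists F : {linear X -> K^o}, [/\ forall x, `|F x| <= `|x|,
    forall e, E e -> F e = 0 & d <= re (F x0)].
Proof.
move=> E0 Elin Ed.
have EZ a x : E x -> E (a *: x) by move=> Ex; rewrite -[_ *: _]addr0; exact: Elin.
have ED x y : E x -> E y -> E (x + y).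
  by move=> Ex Ey; rewrite -[x]scale1r; exact: Elin.
pose S x := [set rnorm (x - e) | e in E].
have hS x : has_inf (S x).
  split; first by exists (rnorm (x - 0)), 0.
  by exists 0 => _ [e _ <-]; exact: rnorm_ge0.
have Sle x e : E e -> inf (S x) <= rnorm (x - e).
  by move=> Ee; apply: (inf_lbound (hS x).2); exists e.
have SE e : E e -> inf (S e) <= 0.
  by move=> Ee; rewrite -rnorm0 -(subrr e); exact: Sle.
have sS : sublinear iota (fun x => inf (S x)).
  apply: sublinearP => [x y||t x t0].
  + rewrite leNgt; apply/negP => h.
    pose e := inf (S (x + y)) - (inf (S x) + inf (S y)).
    have e0 : 0 < e / 2 by rewrite /e; lra.
    have [_ [u Eu <-] h1] := inf_adherent e0 (hS x).
    have [_ [v Ev <-] h2] := inf_adherent e0 (hS y).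
    have := Sle (x + y) (u + v) (ED _ _ Eu Ev); have := rnormD (x - u) (y - v).
    rewrite addrACA -opprD /e in h1 h2 *; lra.
  + apply/eqP; rewrite eq_le SE//=; apply: lb_le_inf; first exact: (hS 0).1.
    by move=> _ [e _ <-]; exact: rnorm_ge0.
  + rewrite mulrC -ler_pdivrMr//; apply: lb_le_inf; first exact: (hS x).1.
    move=> _ [e Ee <-]; rewrite ler_pdivrMr// mulrC.
    apply: le_trans (Sle _ _ (EZ (iota t) _ Ee)) _.
    by rewrite -scalerBr rnormZ norm_scalar// ltW.
have [f [fD fZ fS fx0]] := hahn_banach x0 sS.
have [|F [Ff F1]] := complexify fD fZ.
  by move=> x; apply: le_trans (fS x) _; rewrite -[X in rnorm X]subr0; exact: Sle.
have f0 : f 0 = 0 by have := fD 0 0; rewrite addr0; lra.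
have fE e : E e -> f e = 0.
  move=> Ee; have Ne : E (- e) by rewrite -scaleN1r; exact: EZ.
  have := le_trans (fS _) (SE _ Ee); have := le_trans (fS _) (SE _ Ne).
  have := fD e (- e); rewrite subrr f0; lra.
exists F; split=> //.
- move=> e Ee; have [w w1 wF] := rotate_to_norm (F e).
  apply/eqP; rewrite -normr_eq0 -wF -(real_partK (_ : 0 <= w * F e)) ?wF//.
  by rewrite -wF -[w * _]/(w *: F e) -linearZ /= Ff fE ?rmorph0//; exact: EZ.
- rewrite Ff fx0; apply: lb_le_inf; first exact: (hS x0).1.
  by move=> _ [e Ee <-]; exact: Ed.
Qed.

Lemma norming_functional (x0 : X) : exists F : {linear X -> K^o},
  (forall x, `|F x| <= `|x|) /\ rnorm x0 <= re (F x0).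
Proof.
have [||e ->|F [F1 _ Fx]] := @functional_separation [set 0] x0 (rnorm x0).
- by [].
- by move=> a x y -> ->; rewrite scaler0 addr0.
- by rewrite subr0.
- by exists F.
Qed.

End RealNorm.

End ScalarTheory.

(** * Finite-dimensional subspaces *)

Section Span.
Context {K : numFieldType} {V : lmodType K}.

Fixpoint in_span (s : seq V) (x : V) : Prop :=
  if s is a :: s' then exists c : K, in_span s' (x - c *: a) else x = 0.

Lemma in_span0 s : in_span s 0.
Proof. by elim: s => //= a s IH; exists 0; rewrite scale0r subr0. Qed.

Lemma in_span_linear s (a : K) x y :
  in_span s x -> in_span s y -> in_span s (a *: x + y).
Proof.
elim: s x y => /= [x y -> ->|b s IH x y [c xc] [d yd]].
  by rewrite scaler0 addr0.
exists (a * c + d); have := IH _ _ xc yd.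
by rewrite scalerBr scalerA addrACA -opprD -scalerDl.
Qed.

Lemma in_spanZ s (a : K) x : in_span s x -> in_span s (a *: x).
Proof. by move=> sx; rewrite -[_ *: _]addr0; apply: in_span_linear => //; exact: in_span0. Qed.

Lemma in_spanD s x y : in_span s x -> in_span s y -> in_span s (x + y).
Proof. by move=> sx; rewrite -[x]scale1r; exact: in_span_linear. Qed.

Lemma in_span_sum s (I : Type) (r : seq I) (P : pred I) (F : I -> V) :
  (forall i, P i -> in_span s (F i)) -> in_span s (\sum_(i <- r | P i) F i).
Proof.
by move=> sF; apply: big_ind => //; [exact: in_span0|exact: in_spanD].
Qed.

Lemma in_span_cons a s x : in_span s x -> in_span (a :: s) x.
Proof. by move=> sx; exists 0; rewrite scale0r subr0. Qed.

Lemma in_span_mem s x : x \in s -> in_span s x.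
Proof.
elim: s => //= a s IH; rewrite inE => /predU1P[->|/IH]; last exact: in_span_cons.
by exists 1; rewrite scale1r subrr; exact: in_span0.
Qed.

Lemma finite_dimensionalP :
  finite_dimensional V <-> exists s, forall x, in_span s x.
Proof.
split=> [[n [e eP]]|[s sP]].
  exists (codom e) => x; have [c ->] := eP x.
  by apply: in_span_sum => i _; apply: in_spanZ; apply: in_span_mem; exact: codom_f.
exists (size s), (fun i => s`_i) => x.
elim: s x {sP}(sP x) => [x ->|a s IH x [c /IH[d xd]]].
  by exists (fun=> 0); rewrite big_ord0.
exists (fun i => if unlift ord0 i is Some j then d j else c).
rewrite big_ord_recl unlift_none /=; under eq_bigr do rewrite liftK.
by rewrite -xd subrKC.
Qed.

Let annihilated (Phi : seq {linear V -> K^o}) (x : V) :=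
  List.Forall (fun F : {linear V -> K^o} => F x = 0) Phi.

(** Each further functional costs at most one vector [w], taken in the kernel of the previous ones
    and outside its own. *)
Lemma common_kernel_cofinite (Phi : seq {linear V -> K^o}) :
  exists s, forall x, exists2 y, in_span s (x - y) & annihilated Phi y.
Proof.
elim: Phi => [|F Phi [s sP]].
  by exists [::] => x; exists x; rewrite ?subrr//; exact: List.Forall_nil.
have [[w [w0 Fw]]|nw] := pselect (exists w, annihilated Phi w /\ F w <> 0).
  exists (w :: s) => x; have [y xy y0] := sP x.
  exists (y - (F y / F w) *: w).
    exists (F y / F w); by rewrite opprB addrCA addrAC subrr add0r.
  apply: List.Forall_cons.
    by rewrite linearB linearZ /= [_ *: _](mulfVK (introN eqP Fw)) subrr.
  move: y0 w0; elim=> [_|G Psi Gy _ IH Gw]; first exact: List.Forall_nil.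
  inversion Gw; subst; apply: List.Forall_cons; last exact: IH.
  by rewrite linearB linearZ /= Gy H1 scaler0 subrr.
exists s => x; have [y xy y0] := sP x; exists y => //; apply: List.Forall_cons => //.
by apply: contrapT => Fy; apply: nw; exists y.
Qed.

End Span.

(** * Compactness, Riesz's lemma and finite norming sets for finite spans *)

Section NormedSpan.
Context {R : realType} {k : scalar_kind}.
Local Notation K := (scalars R k).
Local Notation iota := (@scalar_of_real R k).
Local Notation re := (@real_part R k).

Lemma abs_scalar (r : R) : re `|iota r| = `|r|.
Proof.
have [r0|/ltW r0] := leP 0 r; first by rewrite norm_scalar// ger0_norm.
by rewrite -normrN -rmorphN norm_scalar ?oppr_ge0// ler0_norm.
Qed.

Lemma abs_real_part (z : K) : `|re z| <= re `|z|.
Proof.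
have := norm_real_part z; rewrite -[leLHS](real_partK (normr_ge0 _)).
by rewrite -[leRHS](real_partK (normr_ge0 _)) ler_scalar abs_scalar.
Qed.

Lemma cvg_scalar_of_real (T : Type) (F : set_system T) (u : T -> R) (a : R) :
  Filter F -> u @ F --> a -> (fun t => iota (u t)) @ F --> iota a.
Proof.
move=> FF /cvgrPdist_lt ua; apply/cvgrPdist_lt => e e0.
have re0 : 0 < re e by rewrite -(@ltr_scalar _ k) real_partK ?ltW// rmorph0.
apply: filterS (ua _ re0) => t aut; rewrite -rmorphB.
by rewrite -(real_partK (ltW e0)) -(real_partK (normr_ge0 (iota _))) ltr_scalar
  abs_scalar.
Qed.

Lemma scalar_ultra_cvg (T : Type) (U : set_system T) (f : T -> K) (M : R) :
  UltraFilter U -> U [set t | `|f t| <= iota M] -> cvg (f @ U).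
Proof.
move=> UU UM; have [j [c [j1 _ jc]]] := @scalar_decomposition R k.
have reM (z : K) : `|z| <= iota M -> re `|z| <= M.
  by move=> zM; rewrite -(@ler_scalar _ k) real_partK.
have /cvg_ex[a fa] : cvg ((fun t => re (f t)) @ U).
  apply: (@ultra_bounded_cvg _ _ _ _ M); apply: (@filterS _ U) UM => t /= /reM.
  exact: le_trans (abs_real_part _).
have /cvg_ex[b fb] : cvg ((fun t => re (j * f t)) @ U).
  apply: (@ultra_bounded_cvg _ _ _ _ M); apply: (@filterS _ U) UM => t /= fM.
  by apply: le_trans (abs_real_part _) _; apply: reM; rewrite normrM j1 mul1r.
apply/cvg_ex; exists (iota a + c * iota b); rewrite (funext (fun t => jc (f t))).
apply: cvgD; first exact: cvg_scalar_of_real.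
by apply: cvgM; [exact: cvg_cst|exact: cvg_scalar_of_real].
Qed.

Context {X : normedModType K}.

(** Compactness of bounded sets in the span, phrased by convergence along ultrafilters. *)
Let compact_span (s : seq X) := forall (T : Type) (U : set_system T) (f : T -> X) (M : R),
  UltraFilter U -> U [set t | in_span s (f t) /\ rnorm (f t) <= M] ->
  exists2 l, in_span s l & f @ U --> l.

Lemma compact_span_dist (s : seq X) (x : X) : compact_span s -> ~ in_span s x ->
  exists2 d : R, 0 < d & forall v, in_span s v -> d <= rnorm (x - v).
Proof.
move=> cs nx; apply: contrapT => nd; apply: nx.
have /choice[v vP] n : exists v, in_span s v /\ `|x - v| <= n.+1%:R^-1.
  apply: contrapT => nv; apply: nd; exists n.+1%:R^-1; first by rewrite invr_gt0.
  move=> v sv; rewrite leNgt; apply/negP => /ltW; rewrite rnorm_le fmorphV rmorph_nat => xv.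
  by apply: nv; exists v.
have vx : v @ \oo --> x.
  apply/cvgrPdist_lt => e /scalar_archimedean[n ne]; exists n => // m /= nm.
  apply: le_lt_trans ((vP m).2) _; apply: le_lt_trans ne.
  by rewrite lef_pV2 ?posrE// ler_nat.
have [U [UU oU]] := ultra_nat.
have [|l sl vl] := cs _ U v (rnorm x + 1) UU.
  apply: oU; exists 0%N => // n _; split; first exact: (vP n).1.
  rewrite -[v n](subrK x) addrC (le_trans (rnormD _ _))// lerD2l rdistC rnorm_le rmorph1.
  by apply: le_trans (vP n).2 _; rewrite invf_le1// ler1n.
suff -> : x = l by [].
by apply: (@norm_cvg_unique _ _ (v @ U)) => //; apply: cvg_trans vx => A /oU.
Qed.

(** If [a] is not in the span of [s], it has positive distance [d] to it. The coefficient of [a] is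
    then at most [M / d], so it converges along the ultrafilter, and the remainder is bounded in the
    smaller span. *)
Lemma in_span_compact (s : seq X) : compact_span s.
Proof.
elim: s => [|a s IH] T U f M UU Uf.
  exists 0 => //; apply/cvgrPdist_lt => e e0; apply: (@filterS _ U) Uf => t /= [-> _].
  by rewrite subrr normr0.
have [sa|/(compact_span_dist IH)[d d0 dP]] := pselect (in_span s a).
  have [|l sl fl] := IH T U f M UU; last by exists l => //; exact: in_span_cons.
  apply: (@filterS _ U) Uf => t [[c sc] fM]; split=> //.
  by rewrite -[f t](subrK (c *: a)); apply: in_spanD => //; exact: in_spanZ.
have /choice[c cP] t : exists c, in_span (a :: s) (f t) -> in_span s (f t - c *: a).
  have [[c sc]|nsp] := pselect (in_span (a :: s) (f t)); first by exists c.
  by exists 0.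
have cd t : in_span (a :: s) (f t) -> re `|c t| * d <= rnorm (f t).
  move=> /cP sc; have [->|c0] := eqVneq (c t) 0.
    by rewrite normr0 -(rmorph0 iota) scalar_of_realK mul0r rnorm_ge0.
  have -> : f t = c t *: (a - - (c t)^-1 *: (f t - c t *: a)).
    by rewrite scaleNr opprK scalerDr scalerA divff// scale1r subrKC.
  rewrite rnormZ ler_wpM2l//; first by rewrite -(@ler_scalar _ k) rmorph0 real_partK.
  by apply: dP; exact: in_spanZ.
have cM t : in_span (a :: s) (f t) -> rnorm (f t) <= M -> re `|c t| <= M / d.
  by move=> /cd ct tM; rewrite ler_pdivlMr//; exact: le_trans tM.
have /cvg_ex[g cg] : cvg (c @ U).
  apply: (@scalar_ultra_cvg _ _ _ (M / d)); apply: (@filterS _ U) Uf => t [ft tM] /=.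
  by rewrite -(real_partK (normr_ge0 _)) ler_scalar cM.
have [|l sl fl] := IH T U (fun t => f t - c t *: a) (M + M / d * rnorm a) UU.
  apply: (@filterS _ U) Uf => t [ft tM] /=; split; first exact: cP.
  apply: le_trans (rnormD _ _) _; rewrite rnormN rnormZ lerD// ler_wpM2r ?cM//.
  exact: rnorm_ge0.
exists (l + g *: a); first by exists g; rewrite addrK.
have -> : f = (fun t => (f t - c t *: a) + c t *: a) by apply/funext => t; rewrite subrK.
by apply: cvgD => //; apply: cvgZ => //; exact: cvg_cst.
Qed.

(** Taking the distance itself as tolerance gives [v] in the span with [rnorm (x0 - v)] below twice
    the distance; normalizing [x0 - v] yields the constant 1/2. *)
Lemma riesz (s : seq X) : (exists x, ~ in_span s x) -> exists x,
  rnorm x <= 1 /\ forall v, in_span s v -> 2^-1 <= rnorm (x - v).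
Proof.
move=> [x0 /(compact_span_dist (@in_span_compact s))[d d0 dP]].
pose S := [set rnorm (x0 - v) | v in in_span s].
have hS : has_inf S.
  split; first by exists (rnorm (x0 - 0)), 0 => //; exact: in_span0.
  by exists d => _ [v sv <-]; exact: dP.
have D0 : 0 < inf S.
  apply: lt_le_trans d0 _; apply: lb_le_inf; first exact: hS.1.
  by move=> _ [v sv <-]; exact: dP.
have [_ [v sv <-] hv] := inf_adherent D0 hS.
set r := rnorm (x0 - v) in hv; have r0 : 0 < r.
  by apply: lt_le_trans D0 _; apply: (inf_lbound hS.2); exists v.
have ri0 : 0 <= r^-1 by rewrite invr_ge0 ltW.
exists (iota r^-1 *: (x0 - v)); split.
  by rewrite rnormZ norm_scalar// mulVf// gt_eqF.
move=> w sw.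
have -> : iota r^-1 *: (x0 - v) - w = iota r^-1 *: (x0 - (v + iota r *: w)).
  rewrite opprD addrA [RHS]scalerBr scalerA -rmorphM mulVf ?gt_eqF//.
  by rewrite rmorph1 scale1r.
rewrite rnormZ norm_scalar// mulrC ler_pdivlMr// mulrC ler_pdivrMr//.
have : inf S <= rnorm (x0 - (v + iota r *: w)).
  apply: (inf_lbound hS.2); exists (v + iota r *: w) => //.
  by apply: in_spanD => //; exact: in_spanZ.
lra.
Qed.

Lemma In_cat (A : Type) (x : A) (s1 s2 : seq A) :
  List.In x (s1 ++ s2) <-> List.In x s1 \/ List.In x s2.
Proof. by elim: s1 => /= [|a s1 ->]; tauto. Qed.

Lemma In_mkseq (A : Type) (u : nat -> A) (m n : nat) :
  (m < n)%N -> List.In (u m) (mkseq u n).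
Proof.
elim: n => // n IH; rewrite ltnS mkseqS -cats1 leq_eqVlt => mn; apply/In_cat.
by case/predU1P: mn => [->|/IH]; [right; left|left].
Qed.

(** Otherwise there are unit vectors [x n] of the span with norming functionals [F n] such that
    [|F m (x n)| < 1/2] for [m < n], which contradicts compactness. *)
Lemma span_norming (s : seq X) : exists Phi : seq {linear X -> K^o},
  List.Forall (fun F : {linear X -> K^o} => forall x, `|F x| <= `|x|) Phi /\
  forall x, in_span s x -> exists2 F, List.In F Phi & rnorm x <= 2 * re `|F x|.
Proof.
apply: contrapT => nPhi.
pose good (a : X * {linear X -> K^o}) := [/\ in_span s a.1, rnorm a.1 = 1,
  forall x, `|a.2 x| <= `|x| & 1 <= re `|a.2 a.1|].
have [l|u uP] := @history_choice {a | good a}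
    (fun l a => forall b, List.In b l -> 2 * re `|(sval b).2 (sval a).1| < 1).
  (* [F0] keeps [Phi] nonempty, so that the vector 0 also has a functional in it. *)
  have [F0 [F01 _]] := @norming_functional R k X 0.
  pose Phi := F0 :: [seq (sval b).2 | b <- l].
  have [x [sx x0 xP]] : exists x, [/\ in_span s x, x != 0 &
      forall F : {linear X -> K^o}, List.In F Phi -> 2 * re `|F x| < rnorm x].
    apply: contrapT => nx; apply: nPhi; exists Phi; split.
      apply: List.Forall_cons => //.
      elim: l {Phi nx} => [|b l IH]; first exact: List.Forall_nil.
      by apply: List.Forall_cons => //; have [] := svalP b.
    move=> x sx; have [->|x0] := eqVneq x 0.
      exists F0; first by left.
      by rewrite rnorm0 mulr_ge0// -(@ler_scalar _ k) rmorph0 real_partK.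
    apply: contrapT => nF; apply: nx; exists x; split=> // F PhiF.
    by rewrite ltNge; apply/negP => xF; apply: nF; exists F.
  have r0 : 0 < rnorm x by rewrite rnorm_gt0.
  have ri0 : 0 <= (rnorm x)^-1 by rewrite invr_ge0 ltW.
  pose x' := iota (rnorm x)^-1 *: x.
  have x'1 : rnorm x' = 1 by rewrite rnormZ norm_scalar// mulVf// gt_eqF.
  have [F [F1 Fx']] := norming_functional x'.
  have gF : good (x', F).
    split=> //=; first exact: in_spanZ.
    rewrite -x'1; apply: le_trans Fx' _; apply: le_trans (abs_real_part _).
    exact: ler_norm.
  exists (exist _ _ gF) => b lb /=.
  rewrite linearZ /= normrZ -[X in re (X * _)](real_partK (normr_ge0 _)).
  rewrite real_partM norm_scalar// mulrCA mulrC ltr_pdivrMr// mul1r.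
  by apply: xP; right; exact: (List.in_map (fun c : {a | good a} => (sval c).2)).
pose x n := (sval (u n)).1; pose F n := (sval (u n)).2.
have xF m n : (m < n)%N -> 2 * re `|F m (x n)| < 1.
  by move=> mn; apply: uP; exact: In_mkseq.
have [U [UU oU]] := ultra_nat.
have [|l sl xl] := @in_span_compact s _ U x 1 UU.
  by apply: filterE => n; have [? x1 _ _] := svalP (u n); split; rewrite /x ?x1.
(* Two terms within 1/8 of the limit give [1 <= |F m (x m)| < 1/2 + 1/4]. *)
have e0 : 0 < iota 8^-1 by rewrite -(rmorph0 iota) ltr_scalar.
move/cvgrPdist_lt : xl => /(_ _ e0) Ul.
have [m lm] := filter_ex Ul.
have Um : U [set n | (m < n)%N] by apply: oU; exists m.+1.
have [n [ln mn]] := filter_ex (filterI Ul Um).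
move: lm ln; rewrite -!rnorm_lt => lm ln.
have [_ _ F1 Fx] := svalP (u m); rewrite -/(F m) -/(x m) in F1 Fx.
have : re `|F m (x m)| <= re `|F m (x n)| + rnorm (x m - x n).
  rewrite -(@ler_scalar _ k) rmorphD rnormE !real_partK//.
  apply: le_trans (_ : `|F m (x n)| + `|F m (x m - x n)| <= _); last by rewrite lerD2l.
  by rewrite linearB /= -[X in `|X| <= _](subrKC (F m (x n))) ler_normD.
have : rnorm (x m - x n) <= rnorm (l - x m) + rnorm (l - x n).
  by rewrite (rdistC l (x m)) -[x m - x n](subrKA l) rnormD.
have := xF _ _ mn; lra.
Qed.

Lemma opnorm_approx (Y : normedModType K) (T : {linear X -> Y}) (e : K) :
  bounded_operators X Y T -> 0 < e ->
  exists2 x, unit_ball X x & opnorm T - e < `|T x|.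
Proof.
move=> bT e0; have [up least] := opnorm_supremums bT.
have oT0 : 0 <= opnorm T.
  by apply: le_trans (normr_ge0 (T 0)) _; apply: up; exists 0 => //=; rewrite /unit_ball /= normr0.
apply: contrapT => nx.
suff : opnorm T <= opnorm T - e by rewrite lerDl oppr_ge0 => /(lt_le_trans e0); rewrite ltxx.
have er : opnorm T - e \is Num.real by apply: realB; apply: ger0_real => //; exact: ltW.
apply: least => _ [x x1 <-]; rewrite (real_leNgt (ger0_real (normr_ge0 _)) er).
by apply/negP => xe; apply: nx; exists x.
Qed.

Lemma opnorm_le (Y : normedModType K) (T : {linear X -> Y}) (x : X) :
  bounded_operators X Y T -> unit_ball X x -> `|T x| <= opnorm T.
Proof. by move=> bT x1; apply: (opnorm_supremums bT).1; exists x. Qed.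

End NormedSpan.

(** * Quasi norm attainment for bounded operators of finite rank *)

Section FiniteRank.
Context {R : realType} {k : scalar_kind}.
Local Notation K := (scalars R k).

Lemma finite_rank_QNA (X Y : normedModType K) (T : {linear X -> Y}) (s : seq Y) :
  bounded_operators X Y T -> (forall x, in_span s (T x)) -> QNA X Y T.
Proof.
move=> bT sT; split=> //.
have /choice[x xP] n : exists x, unit_ball X x /\ opnorm T - n.+1%:R^-1 < `|T x|.
  have [|x x1 xT] := opnorm_approx bT (_ : 0 < n.+1%:R^-1); first by rewrite invr_gt0.
  by exists x.
have [U [UU oU]] := ultra_nat.
have [|l _ Tl] := @in_span_compact R k Y s _ U (T \o x) (real_part (opnorm T)) UU.
  apply: filterE => n; split; first exact: sT.
  rewrite rnorm_le real_partK; first exact: opnorm_le (xP n).1.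
  exact: le_trans (normr_ge0 _) (opnorm_le bT (xP n).1).
exists l.
  move=> A /Tl UA; have [n An] := filter_ex (UA : U ((T \o x) @^-1` A)).
  by exists (T (x n)); split=> //; exists (x n) => //; exact: (xP n).1.
apply: (@norm_cvg_unique K K^o ((fun n => `|T (x n)|) @ U)); first exact: cvg_norm.
apply: (cvg_trans (cvg_app _ oU)); apply/cvgrPdist_lt => e /scalar_archimedean[n ne].
exists n => // m /= nm.
rewrite ger0_norm ?subr_ge0; last exact: opnorm_le (xP m).1.
rewrite ltrBlDr -ltrBlDl; apply: le_lt_trans (xP m).2; rewrite lerD2l lerN2.
by apply: le_trans (ltW ne); rewrite lef_pV2 ?posrE// ler_nat.
Qed.

Lemma finite_dimensional_QNA (X Y : normedModType K) :
  finite_dimensional X \/ finite_dimensional Y -> QNA X Y = bounded_operators X Y.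
Proof.
move=> fd; apply/seteqP; split=> T; first by case.
move=> bT; case: fd => /finite_dimensionalP[s sP].
  apply: (@finite_rank_QNA _ _ _ (map T s)) bT _ => x.
  elim: s x {sP}(sP x) => [x ->|a s IH x [c /IH xc]] /=; first exact: linear0.
  by exists c; move: xc; rewrite linearB linearZ.
by apply: finite_rank_QNA bT _ => x; exact: sP.
Qed.

End FiniteRank.

(** * The Josefson-Nissenzweig theorem *)

Section WeakStarNull.
Context {R : realType} {k : scalar_kind}.
Local Notation K := (scalars R k).
Local Notation iota := (@scalar_of_real R k).
Local Notation re := (@real_part R k).
Context {X : normedModType K}.

(** These are the real parts of functionals in the closed dual unit ball; they form the set [L]
    given to [null_sequence]. *)
Definition real_functional (g : X -> R) := [/\ forall x y, g (x + y) = g x + g y,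
  forall r x, g (iota r *: x) = r * g x & forall x, g x <= rnorm x].

Lemma real_functional_norm g x : real_functional g -> `|g x| <= rnorm x.
Proof.
move=> [gD gZ gle]; rewrite ler_norml gle andbT.
have := gle (- x); rewrite rnormN -scaleN1r -(rmorph1 iota) -rmorphN gZ; lra.
Qed.

(** Riesz's lemma gives vectors far from the span of the earlier ones, and each functional vanishes
    on that span. At the [m]-th vector the [n]-th functional is therefore 0 while the [m]-th has
    real part at least 1/2. *)
Lemma separated_functionals : ~ finite_dimensional X ->
  exists y : nat -> X -> R, (forall n, real_functional (y n)) /\
    forall m n, (m < n)%N -> exists2 x, rnorm x <= 1 & 2^-1 <= `|y m x - y n x|.
Proof.
move=> nfd.
have [l|u uP] := @history_choice (X * {linear X -> K^o}) (fun l a =>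
    [/\ rnorm a.1 <= 1, forall x, `|a.2 x| <= `|x|,
      forall v, in_span (map fst l) v -> a.2 v = 0 & 2^-1 <= re (a.2 a.1)]).
  have [|x [x1 xP]] := @riesz R k X (map fst l).
    apply: contrapT => /forallNP sP; apply: nfd; apply/finite_dimensionalP.
    by exists (map fst l) => x; apply: contrapT; exact: sP.
  have [||F [F1 Fs Fx]] := functional_separation _ _ xP.
  - exact: in_span0.
  - by move=> a v w; exact: in_span_linear.
  - by exists (x, F).
exists (fun n x => re ((u n).2 x)); split=> [n|m n mn].
  have [_ F1 _ _] := uP n; split=> [x y|r x|x].
  - by rewrite linearD real_partD.
  - by rewrite linearZ /= real_partM.
  - apply: le_trans (ler_norm _) _; apply: le_trans (abs_real_part _) _.
    by rewrite -(@ler_scalar _ k) rnormE real_partK.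
exists (u m).1; first by have [] := uP m.
have [_ _ Fn _] := uP n; have [_ _ _ Fm] := uP m.
have nm : (u n).2 (u m).1 = 0.
  apply: Fn; apply: in_span_mem; rewrite -map_comp; apply/mapP; exists m => //.
  by rewrite mem_iota.
have re0 : re 0 = 0 by rewrite -[X in re X](rmorph0 iota) scalar_of_realK.
by rewrite nm re0 subr0; apply: le_trans Fm (ler_norm _).
Qed.

(** The real null sequence is complexified; convergence of the values follows because [F x] is
    recovered from the real parts at [x] and at [j *: x]. *)
Theorem josefson_nissenzweig : ~ finite_dimensional X ->
  exists (f : nat -> {linear X -> K^o}) (e : R), [/\ 0 < e,
    forall n x, `|f n x| <= `|x|,
    forall x, (fun n => f n x : K) @ \oo --> (0 : K) &
    forall n, exists2 x, unit_ball X x & iota e <= `|f n x|].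
Proof.
move=> /separated_functionals[y [yL ysep]].
have half0 : 0 < 2^-1 :> R by rewrite invr_gt0.
have [||||g [e [e0 gL g0 ge]]] := @null_sequence R X [set x | rnorm x <= 1]
    real_functional _ _ _ _ y 2^-1 yL half0 ysep.
- by move=> g Lg x /= x1; apply: le_trans x1; exact: real_functional_norm.
- move=> g h a b Lg Lh ab.
  have gn := real_functional_norm _ Lg; have hn := real_functional_norm _ Lh.
  case: Lg Lh => gD gZ _ [hD hZ _]; split=> [x x'|r x|x].
  + by rewrite gD hD; ring.
  + by rewrite gZ hZ; ring.
  + apply: le_trans (_ : (`|a| + `|b|) * rnorm x <= _); last first.
      by rewrite ler_piMl// rnorm_ge0.
    rewrite mulrDl; apply: lerD; apply: le_trans (ler_norm _) _;
      by rewrite normrM ler_wpM2l.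
- move=> U G l UU LG Gl.
  have GD n x x' : G n (x + x') = G n x + G n x' by have [] := LG n.
  have GZ n r x : G n (iota r *: x) = r * G n x by have [] := LG n.
  split=> [x x'|r x|x].
  + apply: (@norm_cvg_unique R R^o _ _ _ _ (Gl (x + x'))).
    by rewrite (funext (fun n => GD n x x')); apply: cvgD; exact: Gl.
  + apply: (@norm_cvg_unique R R^o _ _ _ _ (Gl (iota r *: x))).
    by rewrite (funext (fun n => GZ n r x)); apply: cvgMr; exact: Gl.
  + apply: (cvg_le (F := U) (Gl x) (cvg_cst (rnorm x))).
    by apply: filterE => n; have [] := LG n.
- by move=> x; exists (rnorm x) => g Lg; exact: real_functional_norm.
have {}g0 x : (fun n => g n x) @ \oo --> (0 : R).
  have [->|x0] := eqVneq x 0.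
    have -> : (fun n => g n 0) = (fun=> 0); last exact: cvg_cst.
    apply/funext => n; have [gD _ _] := gL n; have := gD 0 0; rewrite addr0; lra.
  have r0 : 0 < rnorm x by rewrite rnorm_gt0.
  have x1 : rnorm (iota (rnorm x)^-1 *: x) <= 1.
    have ri0 : 0 <= (rnorm x)^-1 by rewrite invr_ge0 ltW.
    by rewrite rnormZ norm_scalar// mulVf ?gt_eqF.
  have -> : (fun n => g n x) = (fun n => rnorm x * g n (iota (rnorm x)^-1 *: x)).
    apply/funext => n; have [_ gZ _] := gL n.
    by rewrite gZ mulrA divff ?mul1r// gt_eqF.
  by rewrite -[X in _ --> X](mulr0 (rnorm x)); apply: cvgMr; exact: g0 x1.
have /choice[f fP] n : exists F : {linear X -> K^o},
    (forall x, re (F x) = g n x) /\ forall x, `|F x| <= `|x|.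
  by have [gD gZ gle] := gL n; exact: complexify.
have [j [c [j1 _ jc]]] := @scalar_decomposition R k.
exists f, e; split=> //.
- by move=> n; exact: (fP n).2.
- move=> x.
  have -> : (fun n => f n x : K) = (fun n => iota (g n x) + c * iota (g n (j *: x))).
    apply/funext => n; rewrite [LHS](jc (f n x)) (fP n).1.
    by rewrite -[j * f n x]/(j *: f n x) -linearZ (fP n).1.
  have : (fun n => iota (g n x) + c * iota (g n (j *: x))) @ \oo -->
      iota 0 + c * iota 0.
    by apply: cvgD; [|apply: cvgMr]; apply: cvg_scalar_of_real; exact: g0.
  by rewrite rmorph0 mulr0 addr0.
- move=> n; have [x x1 gx] := ge n; exists x.
    by rewrite /unit_ball /= -(rmorph1 iota) -rnorm_le.
  rewrite -(real_partK (normr_ge0 _)) ler_scalar; apply: le_trans gx _.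
  by rewrite -(fP n).1; exact: abs_real_part.
Qed.

End WeakStarNull.

(** * Operators into c0 that are not quasi norm attaining *)

Section NonAttaining.
Context {R : realType} {k : scalar_kind}.
Local Notation K := (scalars R k).
Local Notation iota := (@scalar_of_real R k).
Local Notation re := (@real_part R k).

(** The shift by 2 keeps [weight 0] positive; the weights increase strictly towards 1, so their
    supremum is not attained. *)
Definition weight (n : nat) : K := 1 - n.+2%:R^-1.

Lemma weight_gt0 n : 0 < weight n.
Proof. by rewrite subr_gt0 invf_lt1// ltr1n. Qed.

Lemma weight_lt1 n : weight n < 1.
Proof. by rewrite ltrBlDr ltrDl invr_gt0. Qed.

Lemma weight_le m n : (m <= n)%N -> weight m <= weight n.
Proof. by move=> mn; rewrite lerD2l lerN2 lef_pV2 ?posrE// ler_nat. Qed.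

Lemma weight_lt n : weight n < weight n.+1.
Proof. by rewrite ltrD2l ltrN2 ltf_pV2 ?posrE// ltr_nat. Qed.

Lemma opnorm_bound (X Y : normedModType K) (T : {linear X -> Y}) (x : X) :
  bounded_operators X Y T -> `|T x| <= opnorm T * `|x|.
Proof.
move=> bT; have [->|x0] := eqVneq x 0; first by rewrite linear0 !normr0 mulr0.
have nx0 : 0 < `|x| by rewrite normr_gt0.
rewrite -ler_pdivrMr// mulrC -[`|x|^-1]ger0_norm ?invr_ge0// -normrZ -linearZ.
apply: opnorm_le bT _; rewrite /unit_ball /= normrZ ger0_norm ?invr_ge0//.
by rewrite mulVf ?gt_eqF.
Qed.

Lemma finite_dimensional_of_QNA_c0 (Z : normedModType K) :
  QNA Z (c0 R k) = bounded_operators Z (c0 R k) -> finite_dimensional Z.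
Proof.
move=> ZQ; apply: contrapT => /josefson_nissenzweig[f [e [e0 f1 f0 fe]]].
have e0' : 0 < iota e by rewrite -(rmorph0 iota) ltr_scalar.
have bf n : bounded_operators Z K^o (f n) by exists 1 => x; rewrite mul1r f1.
have es n : iota e <= opnorm (f n).
  by have [x x1 ex] := fe n; apply: le_trans ex _; exact: opnorm_le (bf n) x1.
have s0 n : 0 < opnorm (f n) by exact: lt_le_trans (es n).
pose t z n : K := weight n / opnorm (f n) * f n z.
have tle z n : `|t z n| <= weight n * `|z|.
  rewrite !normrM normfV (gtr0_norm (weight_gt0 n)) (gtr0_norm (s0 n)) -mulrA.
  apply: ler_wpM2l; first exact: ltW (weight_gt0 n).
  rewrite mulrC ler_pdivrMr// mulrC.
  exact: opnorm_bound (bf n).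
have t0 z : t z \in is_c0 (R:=R) (k:=k).
  (* The norms of the [f n] are at least [e], so dividing by them preserves convergence to 0. *)
  apply/asboolP/cvgrPdist_lt => d d0; have ed : 0 < iota e * d by rewrite mulr_gt0.
  move/cvgrPdist_lt : (f0 z) => /(_ _ ed); apply: filterS => n.
  rewrite !sub0r !normrN => fd; rewrite !normrM normfV.
  rewrite (gtr0_norm (weight_gt0 n)) (gtr0_norm (s0 n)).
  rewrite mulrAC ltr_pdivrMr//; apply: (@le_lt_trans _ _ `|f n z|).
    by rewrite ler_piMl// ltW ?weight_lt1.
  by apply: lt_le_trans fd _; rewrite mulrC ler_pM2l.
have [|T TE] := @linear_of_fun _ Z (c0 R k) (fun z => C0 (t0 z)).
  move=> a x y; apply/val_inj/funext => n /=.
  by rewrite /t linearP mulrDr -[a *: f n x]/(a * f n x) mulrCA.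
have Tn z n : T z n = t z n by rewrite TE.
have bT : bounded_operators Z (c0 R k) T.
  exists 1 => z; rewrite mul1r; apply: (c0_normP (T z)).2 => n; rewrite Tn.
  by apply: le_trans (tle z n) _; rewrite ler_piMl// ltW ?weight_lt1.
have : QNA Z (c0 R k) T by rewrite ZQ.
move=> [_ [u uT un]].
(* The [n]-th coordinate of [T] is a functional of norm [weight n]. *)
have Tw n : weight n <= opnorm T.
  have w0 := weight_gt0 n.
  suff : opnorm (f n) <= opnorm T * opnorm (f n) / weight n.
    by rewrite ler_pdivlMr// mulrC ler_pM2r.
  apply: (opnorm_supremums (bf n)).2 => _ [x x1 <-].
  rewrite ler_pdivlMr// -ler_pdivrMr//.
  apply: le_trans (opnorm_le bT x1); apply: le_trans ((c0_normP (T x)).1 n).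
  rewrite Tn !normrM normfV (gtr0_norm w0) (gtr0_norm (s0 n)).
  by rewrite [leRHS]mulrC mulrA.
have uw n : `|u n| <= weight n.
  apply/ler_addgt0Pr => d d0.
  have [y [[z z1 <-]]] := uT _ (nbhsx_ballx u d d0).
  rewrite -ball_normE /= => ud.
  rewrite -[u n](subrK (T z n)) addrC; apply: le_trans (ler_normD _ _) _.
  apply: lerD.
    rewrite Tn; apply: le_trans (tle z n) _.
    by apply: ler_piMr; [exact: ltW (weight_gt0 n)|exact: z1].
  exact: le_trans ((c0_normP (u - T z)).1 n) (ltW ud).
(* Beyond [N] the coordinates of [u] are below [weight 0], and the earlier ones are at most
   [weight N]. Hence [|u| <= weight N < weight N.+1 <= opnorm T]. *)
have /asboolP/cvgrPdist_lt/(_ _ (weight_gt0 0))[N _ uN] := c0_seqP u.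
have : `|u| <= weight N.
  apply: (c0_normP u).2 => n; have [Nn|/ltnW nN] := leqP N n.
    have := uN n Nn; rewrite sub0r normrN => /ltW un'.
    by apply: le_trans un' (weight_le _).
  exact: le_trans (uw n) (weight_le nN).
by rewrite un => /(le_trans (Tw N.+1)) /(lt_le_trans (weight_lt N)); rewrite ltxx.
Qed.

End NonAttaining.

(** * Operators from l1 that are not quasi norm attaining *)

Section L1Operators.
Context {R : realType} {k : scalar_kind}.
Local Notation K := (scalars R k).
Local Notation iota := (@scalar_of_real R k).
Local Notation re := (@real_part R k).
Context {Z : completeNormedModType K}.

(** The series converges absolutely, hence converges by completeness of [Z]. *)
Lemma l1_synthesis (z : nat -> Z) : (forall n, `|z n| <= 1) ->
  exists T : {linear l1 R k -> Z},
    (forall a : l1 R k, series (fun n => a n *: z n) @ \oo --> T a) /\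
    forall a, `|T a| <= `|a|.
Proof.
move=> z1.
have az (a : l1 R k) n : `|a n *: z n| <= `|a n| by rewrite normrZ ler_piMr.
have ca (a : l1 R k) : cvgn (series (fun n => a n *: z n)).
  apply/cauchy_cvgP/cauchy_seriesP => e e0.
  have /asboolP/cvg_cauchy/cauchy_seriesP/(_ _ e0) := l1_seqP a.
  apply: filterS => -[m n] /=; apply: le_lt_trans.
  rewrite ger0_norm; last by apply: sumr_ge0 => i _.
  by apply: le_trans (ler_norm_sum _ _ _) _; apply: ler_sum => i _.
have [|T TE] := @linear_of_fun _ (l1 R k) Z (fun a => limn (series (fun n => a n *: z n))).
  move=> c a b; apply: cvg_lim; first exact: norm_hausdorff.
  have -> : series (fun n => (c *: a + b : l1 R k) n *: z n) =
      (fun n => c *: series (fun n => a n *: z n) n + series (fun n => b n *: z n) n).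
    apply/funext => n; rewrite /series /= scaler_sumr -big_split /=.
    by apply: eq_bigr => i _; rewrite scalerA -scalerDl.
  by apply: cvgD; [apply: cvgZr; exact: ca|exact: ca].
exists T; split=> a; first by rewrite TE; exact: ca.
apply: (@cvg_norm_le _ _ \oo _ _ (series (fun n => a n *: z n))).
  by rewrite TE; exact: ca.
apply: filterE => n; apply: le_trans ((l1_normP a).1 n).
by apply: le_trans (ler_norm_sum _ _ _) _; apply: ler_sum => i _.
Qed.

Lemma l1_delta (n : nat) : exists a : l1 R k,
  `|a| <= 1 /\ forall m, a m = (m == n)%:R.
Proof.
have dn m : [normed series (fun m => (m == n)%:R : K)] m <= 1.
  rewrite /normed_series_of /series /=.
  have [nm|mn] := ltnP n m; last first.
    rewrite big_nat big1 ?ler01// => i /andP[_ im].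
    by rewrite ltn_eqF ?normr0//; exact: leq_trans mn.
  rewrite big_mkord (bigD1 (Ordinal nm))//= eqxx normr1 big1 ?addr0//.
  by move=> i /eqP ni; rewrite (_ : (i == n :> nat) = false) ?normr0//;
    apply/eqP => ein; apply: ni; exact: val_inj.
have ln := is_l1_bounded dn.
by exists (L1 ln); split=> //; exact: (l1_normP (L1 ln)).2 dn.
Qed.

(** [Phi n] is fixed before [x n], which is then a normalized vector of the common kernel of [Phi n]
    and all earlier sets; that kernel is nonzero because it has finite codimension. *)
Lemma normed_system : ~ finite_dimensional Z ->
  exists (x : nat -> Z) (Phi : nat -> seq {linear Z -> K^o}),
  [/\ forall n, `|x n| = 1,
   forall n F, List.In F (Phi n) -> forall y, `|F y| <= `|y|,
   forall n y, in_span (mkseq x n) y ->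
     exists2 F, List.In F (Phi n) & rnorm y <= 2 * re `|F y| &
   forall n m F, (n <= m)%N -> List.In F (Phi n) -> F (x m) = 0].
Proof.
move=> nfd.
have [l|u uP] := @history_choice (Z * seq {linear Z -> K^o}) (fun l a =>
  [/\ `|a.1| = 1, forall F, List.In F a.2 -> forall y, `|F y| <= `|y|,
   forall y, in_span (map fst l) y ->
     exists2 F, List.In F a.2 & rnorm y <= 2 * re `|F y|,
   forall F, List.In F a.2 -> F a.1 = 0 &
   forall b F, List.In b l -> List.In F b.2 -> F a.1 = 0]).
  have [Phi [Phi1 PhiP]] := span_norming (map fst l).
  have [s sP] := common_kernel_cofinite (Phi ++ flatten (map snd l)).
  have [x nx] : exists x, ~ in_span s x.
    apply: contrapT => /forallNP sx; apply: nfd; apply/finite_dimensionalP.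
    by exists s => x; apply: contrapT; exact: sx.
  have [y xy /List.Forall_forall Fy] := sP x.
  have y0 : y != 0 by apply: contra_notN nx => /eqP y0; rewrite y0 subr0 in xy.
  have Fy' F : List.In F Phi \/ List.In F (flatten (map snd l)) -> F (`|y|^-1 *: y) = 0.
    by move=> /In_cat/Fy Fy0; rewrite linearZ /= Fy0 scaler0.
  exists (`|y|^-1 *: y, Phi); split=> //=.
  - by rewrite normrZ normfV normr_id mulVf// normr_eq0.
  - by move/List.Forall_forall : Phi1.
  - by move=> F PF; apply: Fy'; left.
  - move=> b F lb bF; apply: Fy'; right; elim: l lb {PhiP sP Fy} => //= c l IH.
    by case=> [->|/IH lF]; apply/In_cat; [left|right].
exists (fun n => (u n).1), (fun n => (u n).2); split.
- by move=> n; have [] := uP n.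
- by move=> n; have [] := uP n.
- move=> n y; have [_ _ + _ _] := uP n; rewrite -map_comp; exact.
- move=> n m F; rewrite leq_eqVlt => /predU1P[->|nm] nF.
    by have [_ _ _ + _] := uP m; apply.
  by have [_ _ _ _] := uP m; apply; [exact: In_mkseq nm|].
Qed.

Lemma cvg_bounded_linear (F : {linear Z -> K^o}) (I : Type) (G : set_system I)
    (f : I -> Z) (l : Z) {FG : Filter G} : (forall y, `|F y| <= `|y|) -> f @ G --> l ->
  (fun i => F (f i) : K) @ G --> (F l : K).
Proof.
move=> F1 /cvgrPdist_lt fl; apply/cvgrPdist_lt => e e0.
apply: filterS (fl _ e0) => i; apply: le_lt_trans.
by rewrite -[X in `|X| <= _]linearB.
Qed.

Lemma finite_dimensional_of_QNA_l1 :
  QNA (l1 R k) Z = bounded_operators (l1 R k) Z -> finite_dimensional Z.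
Proof.
move=> ZQ; apply: contrapT => /normed_system[x [Phi [x1 Phi1 PhiP Phi0]]].
pose z n := weight n *: x n : Z.
have zw n : `|z n| = weight n :> K.
  by rewrite normrZ x1 mulr1 gtr0_norm// weight_gt0.
have [|T [Tser T1]] := @l1_synthesis z; first by move=> n; rewrite zw ltW// weight_lt1.
have bT : bounded_operators (l1 R k) Z T by exists 1 => a; rewrite mul1r T1.
have : QNA (l1 R k) Z T by rewrite ZQ.
move=> [_ [u uT un]].
have Tw n : weight n <= opnorm T.
  have [a [a1 an]] := l1_delta n; rewrite -(zw n).
  suff -> : z n = T a by exact: opnorm_le bT a1.
  apply: (@norm_cvg_unique _ _ _ _ _ _ _ (Tser a)).
  apply: cvg_near_cst; exists n.+1 => // m /= nm.
  rewrite /series /= big_mkord (bigD1 (Ordinal nm))//= an eqxx scale1r big1 ?addr0//.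
  move=> i /eqP ni; rewrite an (_ : (i == n :> nat) = false) ?scale0r//.
  by apply/eqP => ein; apply: ni; exact: val_inj.
have /choice[b bP] j : exists b : l1 R k, `|b| <= 1 /\ `|u - T b| < j.+1%:R^-1.
  have j0 : 0 < j.+1%:R^-1 :> K by rewrite invr_gt0.
  by have [y [[b b1 <-]]] := uT _ (nbhsx_ballx u _ j0); rewrite -ball_normE; exists b.
have [U [UU oU]] := ultra_nat.
have Tbu : (fun j => T (b j)) @ U --> u.
  apply: (cvg_trans (cvg_app _ oU)); apply/cvgrPdist_lt => e /scalar_archimedean[n ne].
  exists n => // m /= nm; apply: lt_trans (bP m).2 _; apply: le_lt_trans ne.
  by rewrite lef_pV2 ?posrE// ler_nat.
have /choice[alpha bal] n : exists l : K, (fun j => b j n) @ U --> l.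
  apply/cvg_ex; apply: (@scalar_ultra_cvg _ _ _ _ _ 1 UU); apply: filterE => j /=.
  by rewrite rmorph1; apply: le_trans (l1_norm_ge_coord _ _) (bP j).1.
have alpha1 n : [normed series alpha] n <= 1.
  apply: (cvg_le (F := U) (cvg_normed_series (u := fun i j => b j i) bal) (cvg_cst (1 : K))).
  by apply: filterE => j; apply: le_trans ((l1_normP (b j)).1 n) (bP j).1.
pose a : l1 R k := L1 (is_l1_bounded alpha1).
(* [F] kills [z i] for [i >= n], so [F (T c)] depends on finitely many coordinates and follows
   coordinatewise limits. *)
have FT n F (c : l1 R k) : List.In F (Phi n) -> F (T c) = \sum_(i < n) c i * F (z i) :> K.
  move=> nF; apply: (@norm_cvg_unique K K^o _ _ _ _
    (@cvg_bounded_linear F _ \oo _ _ _ (Phi1 n F nF) (Tser c))).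
  apply: cvg_near_cst; exists n => // m /= nm.
  rewrite /series /= linear_sum big_mkord -(subnKC nm) big_split_ord /=.
  rewrite [X in _ + X]big1 ?addr0; last first.
    by move=> i _; rewrite !linearZ /= (Phi0 n) ?leq_addr// !scaler0.
  by apply: eq_bigr => i _; rewrite linearZ.
have uTa n F : List.In F (Phi n) -> F u = F (T a).
  move=> nF; apply: (@norm_cvg_unique K K^o _ _ _ _
    (@cvg_bounded_linear F _ U _ _ _ (Phi1 n F nF) Tbu)).
  rewrite (funext (fun j => FT n F (b j) nF)) (FT n F a nF).
  by apply: (cvg_ord_sum (f := fun i j => b j i * F (z i))
      (l := fun i => alpha i * F (z i))) => i; apply: cvgM; [exact: bal|exact: cvg_cst].
have sspan n (c : l1 R k) : in_span (mkseq x n) (series (fun i => c i *: z i) n).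
  rewrite /series /= big_mkord; apply: in_span_sum => i _; rewrite scalerA.
  by apply: in_spanZ; apply: in_span_mem; apply: map_f; rewrite mem_iota /= add0n.
have {uTa FT} uE : u = T a.
  apply/eqP; rewrite -subr_eq0; apply: contraT => v0.
  set v := u - T a in v0; have nv0 : 0 < rnorm v by rewrite rnorm_gt0.
  (* For [y = y1 - y2], a norming functional that kills [v] gives [|y| <= 2 |v - y|]. Three errors
     below [|v| / 10] then yield [|v| <= 3 |v - y| < 9/10 |v|]. *)
  have e0 : 0 < iota (rnorm v / 10).
    by rewrite -(rmorph0 iota) ltr_scalar divr_gt0.
  move/cvgrPdist_lt : Tbu => /(_ _ e0) /filter_ex[j uj].
  have /cvgrPdist_lt/(_ _ e0)[N1 _ N1P] := Tser (b j).
  have /cvgrPdist_lt/(_ _ e0)[N2 _ N2P] := Tser a.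
  pose n := maxn N1 N2.
  have h1 := N1P n (leq_maxl _ _); have h2 := N2P n (leq_maxr _ _).
  set y1 := series _ n in h1; set y2 := series _ n in h2.
  have [|F nF Fy] := PhiP n (y1 - y2).
    by rewrite -scaleN1r addrC; apply: in_span_linear; exact: sspan.
  have hv : rnorm (v - (y1 - y2)) <= rnorm (u - T (b j)) + rnorm (T (b j) - y1) + rnorm (T a - y2).
    have -> : v - (y1 - y2) = u - T (b j) + (T (b j) - y1) - (T a - y2).
      by rewrite /v subrKA !opprB [y2 - y1]addrC [y2 - T a]addrC addrACA.
    apply: le_trans (rnormD _ _) _; rewrite rnormN lerD2r; exact: rnormD.
  have Fv : re `|F (y1 - y2)| <= rnorm (v - (y1 - y2)).
    rewrite -(@ler_scalar _ k) rnormE real_partK//.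
    rewrite -[y1 - y2 in leLHS](subKr v) linearB [F v]linearB (uTa _ _ nF) subrr sub0r normrN.
    exact: Phi1 nF _.
  have := rnormD (v - (y1 - y2)) (y1 - y2); rewrite subrK.
  by move: uj h1 h2; rewrite -!rnorm_lt; lra.
have [a0|/existsNP[n0 /eqP an0]] := pselect (forall n, alpha n = 0).
  have aE : a = 0 by apply/val_inj/funext => n; exact: a0.
  have := lt_le_trans (weight_gt0 0) (Tw 0%N).
  by rewrite -un uE aE linear0 normr0 ltxx.
(* The factor [weight n0] costs [|alpha n0| / (n0 + 2)], whence [|u| <= 1 - d], while the weights,
   all at most [opnorm T], come arbitrarily close to 1. *)
pose d := `|alpha n0| / n0.+2%:R.
have d0 : 0 < d by rewrite divr_gt0 ?normr_gt0.
have ud : `|u| <= 1 - d.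
  rewrite uE; apply: (@cvg_norm_le _ _ \oo _ _ _ _ _ (Tser a)).
  exists n0.+1 => // m /= n0m; apply: le_trans (ler_norm_sum _ _ _) _.
  apply: (@le_trans _ _ ([normed series alpha] m - d)); last by rewrite lerD2r.
  rewrite /normed_series_of /series /= !big_mkord.
  rewrite (bigD1 (Ordinal n0m))//= [X in _ <= X - _](bigD1 (Ordinal n0m))//= addrAC.
  apply: lerD.
    by rewrite normrZ zw /d /weight mulrBr mulr1.
  by apply: ler_sum => i _; rewrite normrZ zw ler_piMr// ltW// weight_lt1.
have [n nd] := scalar_archimedean d0.
have := le_trans (Tw n) (le_trans (_ : opnorm T <= `|u|) ud); rewrite un => /(_ (lexx _)).
rewrite lerD2l lerN2 => /(lt_le_trans nd); rewrite ltf_pV2 ?posrE// ltr_nat; lia.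
Qed.

End L1Operators.

(** * The cycle of implications, where (c) leads to (d) through (a) *)

Theorem corollary4p5 (R : realType) (k : scalar_kind)
    (Z : completeNormedModType (scalars R k)) :
  [<-> finite_dimensional Z;
       forall Y : completeNormedModType (scalars R k),
         QNA Z Y = bounded_operators Z Y;
       QNA Z (c0 R k) = bounded_operators Z (c0 R k);
       forall X : completeNormedModType (scalars R k),
         QNA X Z = bounded_operators X Z;
       QNA (l1 R k) Z = bounded_operators (l1 R k) Z].
Proof.
tfae.
- by move=> fZ Y; apply: finite_dimensional_QNA; left.
- exact.
- move=> /finite_dimensional_of_QNA_c0 fZ X.
  by apply: finite_dimensional_QNA; right.
- exact.
- exact: finite_dimensional_of_QNA_l1.
Qed.
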